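(* Let $\mu\ge -1/2$ and $\alpha\in(0,\pi)$ be fixed, let $m\in\mathbb{R}$, and let $L:(0,\infty)\to(0,\infty)$ be a measurable function that is slowly varying at the origin and for which there exist constants $C_1,C_2>0$ with $C_1<L(x)<C_2$ for all $x>1$. Let $f\in\mathcal{K}'_\mu(\mathbb{R}_+)$ be quasi-asymptotically bounded of degree $m$ at the origin with respect to $L$ in $\mathcal{K}'_\mu(\mathbb{R}_+)$, i.e. for every $\varphi\in\mathcal{K}_\mu(\mathbb{R}_+)$ there is a constant $C_\varphi>0$ (depending on $\varphi$) such that $$|\langle f(\varepsilon x),\varphi(x)\rangle|\le C_\varphi\,\varepsilon^m L(\varepsilon)\quad\text{as }\varepsilon\to0^+ .$$ Then for every $\varphi\in\mathcal{K}_\mu(\mathbb{R}_+)$ there exists $C>0$ such that $$\Big|\Big\langle e^{i c_1(\xi/\varepsilon)^2/2}\,H_\mu^\alpha f\Big(\frac{\xi}{\varepsilon}\Big),\varphi(\xi)\Big\rangle\Big|\le C\,\varepsilon^{m+1}L(\varepsilon)\quad\text{as }\varepsilon\to0^+,$$ where $c_1=\cot\alpha$.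
   Context: $\mathbb{R}_+=(0,\infty)$, $\mathbb{N}_0=\{0,1,2,\dots\}$, $D=d/dx$. For $\mu\ge-1/2$, $\mathcal{K}_\mu(\mathbb{R}_+)$ is the space of smooth $\varphi:\mathbb{R}_+\to\mathbb{C}$ with $\gamma^\mu_{m,k}(\varphi)=\sup_{x>0}|x^m(x^{-1}D)^k(x^{-\mu-1/2}\varphi(x))|<\infty$ for all $m,k\in\mathbb{N}_0$, with the Fréchet topology given by the norms $\gamma^\mu_r(\varphi)=\max_{0\le m,k\le r}\gamma^\mu_{m,k}(\varphi)$, $r\in\mathbb{N}_0$. $\mathcal{K}'_\mu(\mathbb{R}_+)$ is its topological dual. Dilations: for $F\in\mathcal{K}'_\mu(\mathbb{R}_+)$ and $a>0$, $\langle F(ax),\varphi(x)\rangle=a^{-1}\langle F(x),\varphi(x/a)\rangle$. Multiplication of $F$ by the function $e^{icx^2/2}$ ($c\in\mathbb{R}$) is defined by $\langle e^{icx^2/2}F,\varphi\rangle=\langle F,e^{icx^2/2}\varphi\rangle$. A positive measurable function $L$ is slowly varying at the origin if $\lim_{\varepsilon\to0^+}L(a\varepsilon)/L(\varepsilon)=1$ for each $a>0$. An inequality ''as $\varepsilon\to0^+$'' means that it holds for all sufficiently small $\varepsilon>0$ (the threshold may depend on $\varphi$). Fractional Hankel transform (FrHT): for $\alpha\in(0,\pi)$ put $c_1=\cot\alpha$, $c_2=\csc\alpha$, $C_{\alpha,\mu}=e^{i(1+\mu)(\pi/2-\alpha)}/\sin\alpha$ and $$K_\alpha(x,\xi)=C_{\alpha,\mu}e^{-i\frac{x^2+\xi^2}{2}c_1}\sqrt{x\xi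 c_2}\,J_\mu(x\xi c_2),$$ which for $\alpha=\pi/2$ is $\sqrt{x\xi}J_\mu(x\xi)$; here $J_\mu$ is the Bessel function of the first kind of order $\mu$. For $\varphi\in\mathcal{K}_\mu(\mathbb{R}_+)$, $H_\mu^\alpha\varphi(\xi)=\int_0^\infty K_\alpha(x,\xi)\varphi(x)\,dx$; this is a continuous linear map of $\mathcal{K}_\mu(\mathbb{R}_+)$ onto itself. For $f\in\mathcal{K}'_\mu(\mathbb{R}_+)$, $H_\mu^\alpha f\in\mathcal{K}'_\mu(\mathbb{R}_+)$ is defined by $\langle H_\mu^\alpha f,\varphi\rangle=\langle f,H_\mu^\alpha\varphi\rangle$. *)

(* Defs.v *)
From HB Require Import structures.
From mathcomp Require Import all_boot all_order all_algebra.
From mathcomp Require Import all_classical all_reals all_analysis.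
From mathcomp Require Import measurable_realfun.
From mathcomp.real_closed Require Import complex.

Set Implicit Arguments.
Unset Strict Implicit.
Unset Printing Implicit Defensive.

Import Order.TTheory GRing.Theory Num.Theory.
Import numFieldNormedType.Exports.

Local Open Scope classical_set_scope.
Local Open Scope ring_scope.
Local Open Scope complex_scope.

(* Functions on R_+ = (0, oo) are represented by total functions R -> R[i];
   their values outside (0, oo) are irrelevant. *)

Section complex_calculus.
Context {R : realType}.
Implicit Types f : R -> R[i].

Definition Rplus : set R := [set x | 0 < x].

Definition cabs (z : R[i]) : R := ComplexField.Normc.normc z.

Definition cis (t : R) : R[i] := cos t +i* sin t.

Definition cderive1 f : R -> R[i] :=
  fun x => derive1 (fun y => complex.Re (f y)) x +i*
    derive1 (fun y => complex.Im (f y)) x.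

Definition smooth_Rplus f : Prop :=
  forall (n : nat) (x : R), 0 < x ->
    derivable (fun y => complex.Re (iter n cderive1 f y)) x 1 /\
    derivable (fun y => complex.Im (iter n cderive1 f y)) x 1.

Definition cintegral_Rplus f : R[i] :=
  Rintegral lebesgue_measure Rplus (fun x => complex.Re (f x)) +i*
  Rintegral lebesgue_measure Rplus (fun x => complex.Im (f x)).

End complex_calculus.

Section Kmu_space.
Context {R : realType}.
Variable mu : R.
Implicit Types phi psi : R -> R[i].

Definition xinvD phi : R -> R[i] := fun x => (x^-1)%:C * cderive1 phi x.

Definition gamma_mk (m k : nat) phi : \bar R :=
  ereal_sup [set (cabs ((x ^+ m)%:C *
    iter k xinvD (fun y => (y `^ (- mu - 2^-1))%:C * phi y) x))%:E
    | x in Rplus].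

Definition gamma_r (r : nat) phi : \bar R :=
  \big[maxe/0%E]_(m < r.+1) \big[maxe/0%E]_(k < r.+1) gamma_mk m k phi.

Definition Kmu : set (R -> R[i]) :=
  [set phi | smooth_Rplus phi /\ forall m k, (gamma_mk m k phi < +oo)%E].

(* An element of the dual is a total functional of which only the values on
   Kmu matter.  Since the gamma_r are increasing in r, the sets
   [set psi | gamma_r r (psi - phi) < delta] form a neighbourhood base at phi.
   Continuity forces F to agree on functions that agree on (0, oo). *)
Definition Kmu_dual (F : (R -> R[i]) -> R[i]) : Prop :=
  [/\ forall (a : R[i]) phi psi, Kmu phi -> Kmu psi ->
        F (fun x => a * phi x + psi x) = a * F phi + F psi
    & forall phi, Kmu phi -> forall eps : R, 0 < eps ->
        exists (r : nat) (delta : R), 0 < delta /\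
          forall psi, Kmu psi ->
            (gamma_r r (fun x => (psi x - phi x)%R) < delta%:E)%E ->
            cabs (F psi - F phi) < eps].

End Kmu_space.

Section operations.
Context {R : realType}.
Implicit Types F : (R -> R[i]) -> R[i].

(* F(a x) *)
Definition dilate (a : R) F : (R -> R[i]) -> R[i] :=
  fun phi => (a^-1)%:C * F (fun x => phi (x / a)).

(* e^{i c x^2 / 2} F *)
Definition chirp_mul (c : R) F : (R -> R[i]) -> R[i] :=
  fun phi => F (fun x => cis (c * x ^+ 2 / 2) * phi x).

End operations.

Section slow_variation.
Context {R : realType}.

(* Measurability is with respect to Lebesgue (not only Borel) sets. *)
Definition lebesgue_measurable_Rplus (L : R -> R) : Prop :=
  measurable_fun
    (Rplus : set (g_sigma_algebraType
                    (completed_algebra_gen (@lebesgue_measure R))))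
    L.

Definition slowly_varying0 (L : R -> R) : Prop :=
  [/\ lebesgue_measurable_Rplus L,
      forall x, 0 < x -> 0 < L x
    & forall a, 0 < a -> L (a * e) / L e @[e --> 0^'+] --> (1 : R)].

Definition quasi_asymp_bounded0 (mu m : R) (L : R -> R)
    (f : (R -> R[i]) -> R[i]) : Prop :=
  forall phi, Kmu mu phi ->
    exists C : R, 0 < C /\
      \forall e \near 0^'+, cabs (dilate e f phi) <= C * (e `^ m * L e).

End slow_variation.

Section fractional_hankel.
Context {R : realType}.

(* Euler's integral, used for s > 0 only *)
Definition Gamma_fun (s : R) : R :=
  Rintegral lebesgue_measure Rplus (fun t => t `^ (s - 1) * expR (- t)).

(* Bessel function of the first kind, for nu > -1 and x > 0 *)
Definition besselJ (nu x : R) : R :=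
  limn (series (fun k : nat =>
    (-1) ^+ k / (k`!%:R * Gamma_fun (k%:R + nu + 1))
    * (x / 2) `^ (2 * k%:R + nu))).

Definition cot (alpha : R) : R := cos alpha / sin alpha.
Definition csc (alpha : R) : R := (sin alpha)^-1.

Definition frht_const (mu alpha : R) : R[i] :=
  cis ((1 + mu) * (pi / 2 - alpha)) * ((sin alpha)^-1)%:C.

Definition frht_kernel (mu alpha x xi : R) : R[i] :=
  frht_const mu alpha
  * cis (- ((x ^+ 2 + xi ^+ 2) / 2 * cot alpha))
  * (Num.sqrt (x * xi * csc alpha) * besselJ mu (x * xi * csc alpha))%:C.

Definition frht (mu alpha : R) (phi : R -> R[i]) : R -> R[i] :=
  fun xi => cintegral_Rplus (fun x => frht_kernel mu alpha x xi * phi x).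

Definition frht_dual (mu alpha : R) (f : (R -> R[i]) -> R[i]) :
    (R -> R[i]) -> R[i] :=
  fun phi => f (frht mu alpha phi).

End fractional_hankel.

(* Main.v *)
Require Import Defs.
From mathcomp Require Import all_boot all_order all_algebra.
From mathcomp Require Import all_classical all_reals all_analysis.
From mathcomp Require Import measurable_realfun ring lra.
From mathcomp.real_closed Require Import complex.
Set Implicit Arguments.
Unset Strict Implicit.
Unset Printing Implicit Defensive.
Import Order.TTheory GRing.Theory Num.Theory.
Import numFieldNormedType.Exports.
Local Open Scope classical_set_scope.
Local Open Scope ring_scope.

(** The FrHT of a dilated and chirped test function is again a dilated and
    chirped function: if [h] is the ordinary Hankel transform of [phi], then
    the quantity to be bounded is [C_(alpha, mu) e <f(e x), Phi_e(x)>] with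
    [Phi_e(x) = exp(- i c_1 (e x)^2 / 2) h(c_2 x)].  For [e <= 1] the [Phi_e]
    stay in a bounded subset of [K_mu], so the Banach-Steinhaus theorem turns
    the pointwise bounds on [f(e x) / (e^m L(e))] into the required one.

    That [h] belongs to [K_mu] is seen on [j(z) = z^(-mu) J_mu(z)], an even
    entire function, bounded on the half line: applying [x^-1 D] to [h]
    raises the order [mu], and multiplying [h] by [x^2] amounts to applying
    the Bessel operator to [phi]. *)

(** * Calculus on the half line *)

(** The obstacle is that the test function Phi_e moves with e, while the hypothesis gives a constant
    and a threshold for one fixed test function at a time. The chirp in front of the transform keeps
    Phi_e under control: it cancels the chirp of the kernel in the integration variable, and the
    chirp left in the other variable becomes, after rescaling, exp(- i c_1 e^2 x^2 / 2), with |c_1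
    e^2| <= |c_1| for e <= 1. Such chirps preserve boundedness in K_mu because x^-1 D draws only the
    constant i c out of exp(i c x^2 / 2).

    Since the threshold depends on the test function, uniformity is proved by contradiction: a
    failure yields points e_k tending to 0 where the bound is exceeded by the factor 4^k, and a
    single sum of terms 3^-k psi_k with suitable signs then violates the hypothesis along e_k. The
    sum is built directly inside K_mu, whose elements are written as x^(mu + 1/2) times a pair of
    real families u_k with u_k' = x u_(k+1). Smoothness, seminorms and bounded sets are all read off
    bounds on these families. *)

Section derivation_rules.
Context {R : realType}.
Implicit Types (f g : R -> R) (x a b c : R).

Lemma is_derive1_ext f g x a b : 0 < x -> (forall y, 0 < y -> f y = g y) -> a = b ->
  is_derive x 1 f a -> is_derive x 1 g b.
Proof.
move=> x0 fg <-; apply: near_eq_is_derive.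
by near=> y; apply: fg; near: y; exact: lt_nbhsr.
Unshelve. all: by end_near. Qed.

Lemma is_derive1D f g x a b : is_derive x 1 f a -> is_derive x 1 g b ->
  is_derive x 1 (fun y => f y + g y) (a + b).
Proof. exact: is_deriveD. Qed.

Lemma is_derive1M f g x a b : is_derive x 1 f a -> is_derive x 1 g b ->
  is_derive x 1 (fun y => f y * g y) (a * g x + f x * b).
Proof.
move=> df dg; apply: (is_derive_eq (is_deriveM df dg)).
by rewrite /GRing.scale/=; ring.
Qed.

Lemma is_derive1Z f x a c : is_derive x 1 f a -> is_derive x 1 (fun y => c * f y) (c * a).
Proof.
move=> df; have dc : is_derive x 1 (fun _ : R => c) 0 by exact: is_derive_cst.
by have := is_derive1M dc df; rewrite mul0r add0r.
Qed.

Lemma is_derive1_compf f g x a b : is_derive (g x) 1 f a -> is_derive x 1 g b ->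
  is_derive x 1 (fun y => f (g y)) (a * b).
Proof. exact: is_derive1_comp. Qed.

Lemma is_derive1_scale f x a c : is_derive (c * x) 1 f a ->
  is_derive x 1 (fun y => f (c * y)) (c * a).
Proof.
move=> df; rewrite mulrC; apply: is_derive1_compf df _.
by have := is_derive1Z c (is_derive_id x (1 : R)); rewrite mulr1.
Qed.

Lemma is_derive1_continuous f x a : is_derive x 1 f a -> {for x, continuous f}.
Proof. by move=> df; apply/differentiable_continuous/derivable1_diffP/ex_derive. Qed.

Lemma is_derive_sqr x : is_derive x 1 (fun y : R => y ^+ 2) (2 * x).
Proof.
have h : is_derive x 1 (fun y : R => y ^+ 2) (1 * x + x * 1).
  exact: (@is_derive1M id id).
by apply: (is_derive_eq h); ring.
Qed.

End derivation_rules.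

(** * Integration over the half line *)

Section half_line.
Context {R : realType}.
Implicit Types (f g F a b : R -> R).
Local Notation mu := (@lebesgue_measure R).

Lemma RplusE : Rplus = `]0, +oo[%classic :> set R.
Proof. by apply/seteqP; split => x /=; rewrite in_itv/= andbT. Qed.

Lemma open_Rplus : open (Rplus : set R). Proof. by rewrite RplusE; exact: interval_open.
  Qed.

Lemma measurable_Rplus : measurable (Rplus : set R).
Proof. by rewrite RplusE; exact: measurable_itv. Qed.

Lemma measurable_fun_Rplus f : (forall x : R, 0 < x -> {for x, continuous f}) ->
  measurable_fun Rplus f.
Proof.
move=> cf; apply: open_continuous_measurable_fun; first exact: open_Rplus.
by move=> x; rewrite inE => /cf.
Qed.

Lemma within_continuous_Rplus f (u v : R) : 0 < u ->
  (forall x : R, 0 < x -> {for x, continuous f}) -> {within `[u, v], continuous f}.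
Proof.
move=> u0 cf; apply: continuous_in_subspaceT => x; rewrite inE/= in_itv/= => /andP[ux _].
by apply: cf; exact: lt_le_trans ux.
Qed.

(** The free factors [u] and [v] let a dilation by [c] carry one such exhaustion to another, as
    [ge0_integral_scale] requires. *)
Lemma Rplus_exhaustion f (u v : R) : 0 < u -> 0 < v ->
  (forall x : R, 0 < x -> {for x, continuous f}) -> (forall x : R, 0 < x -> 0 <= f x) ->
  (\int[mu]_(x in `[(u / n.+1%:R)%R, (v * n.+1%:R)%R]) (f x)%:E)%E @[n --> \oo]
    --> (\int[mu]_(x in Rplus) (f x)%:E)%E.
Proof.
move=> u0 v0 cf f0.
pose I n : set R := `[u / n.+1%:R, v * n.+1%:R]%classic.
have subI n : I n `<=` Rplus.
  by move=> x; rewrite /I/= in_itv/= => /andP[+ _]; apply: lt_le_trans; rewrite divr_gt0.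
have -> : Rplus = \bigcup_n I n.
  apply/seteqP; split => [x /= x0|x [n _]]; last exact: subI.
  pose k := (Num.truncn (u / x) + Num.truncn (x / v))%N.
  exists k => //; rewrite /I/= in_itv/=.
  have h (y : R) n : (Num.truncn y <= n)%N -> y <= n.+1%:R.
    by move=> yn; apply: le_trans (ltW (truncnS_gt y)) _; rewrite ler_nat.
  have -> : u / k.+1%:R <= x.
    by rewrite ler_pdivrMr// mulrC -ler_pdivrMr//; apply: h; exact: leq_addr.
  by rewrite mulrC -ler_pdivrMr//; apply: h; exact: leq_addl.
apply: ge0_nondecreasing_set_cvg_integral.
- apply/nondecreasing_seqP => n; rewrite subsetEset => x; rewrite /I/=.
  rewrite !in_itv/= => /andP[ux xv]; apply/andP; split.
    by apply: le_trans ux; rewrite ler_pM2l// lef_pV2 ?posrE// ler_nat.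
  by apply: le_trans xv _; rewrite ler_pM2l// ler_nat.
- by move=> i; exact: measurable_itv.
- move=> i; apply/measurable_EFinP; apply: measurable_funS (subI i) _.
    exact: measurable_Rplus.
  exact: measurable_fun_Rplus.
- by move=> i x /subI x0; rewrite lee_fin; exact: f0.
Qed.

(** On [1/(n+1), n+1] the two integrals differ by an increment of [F], which tends to 0. The
    equality is one of extended reals, so it also covers infinite integrals; the Gamma integral is
    treated in this form. *)
Lemma ge0_FTC_Rplus F a b :
  (forall x : R, 0 < x -> is_derive x 1 F (a x - b x)) ->
  (forall x : R, 0 < x -> {for x, continuous a}) ->
  (forall x : R, 0 < x -> {for x, continuous b}) ->
  (forall x : R, 0 < x -> 0 <= a x) -> (forall x : R, 0 < x -> 0 <= b x) ->
  F x @[x --> 0^'+] --> 0 -> F x @[x --> +oo%R] --> 0 ->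
  (\int[mu]_(x in Rplus) (a x)%:E = \int[mu]_(x in Rplus) (b x)%:E)%E.
Proof.
move=> dF ca cb a0 b0 F0 Foo.
have cva := Rplus_exhaustion ltr01 ltr01 ca a0.
have cvb := Rplus_exhaustion ltr01 ltr01 cb b0.
have cFu : (F (n.+1%:R) - F (n.+1%:R^-1)) @[n --> \oo] --> (0 : R).
  rewrite -[X in _ --> X](subr0 0); apply: cvgB.
    apply: cvg_comp Foo; apply/cvgryPge => A.
    near=> n; apply: le_trans (ltW (truncnS_gt A)) _.
    by rewrite ler_nat ltnS; near: n; exact: nbhs_infty_ge.
  by move/cvg_at_rightP: F0; apply; split => //; exact: cvg_harmonic.
have key n : (\int[mu]_(x in `[(1 / n.+1%:R)%R, (1 * n.+1%:R)%R]) (a x)%:E =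
    (F n.+1%:R - F n.+1%:R^-1)%:E
    + \int[mu]_(x in `[(1 / n.+1%:R)%R, (1 * n.+1%:R)%R]) (b x)%:E)%E.
  rewrite !mul1r.
  case: n => [|n].
    (* For n = 0 the interval is the single point 1, whereas the fundamental theorem wants distinct
       endpoints. *)
    by rewrite invr1 set_itv1 !integral_set1 subrr adde0.
  have n0 : 0 < n.+2%:R^-1 :> R by rewrite invr_gt0.
  have lt : n.+2%:R^-1 < n.+2%:R :> R.
    by rewrite (@lt_trans _ _ 1)// ?invf_lt1// ltr1n.
  have ia f : (forall x : R, 0 < x -> {for x, continuous f}) ->
      mu.-integrable `[n.+2%:R^-1, n.+2%:R] (EFin \o f).
    move=> cf; apply: continuous_compact_integrable; first exact: segment_compact.
    exact: within_continuous_Rplus.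
  have in0 x : x \in `]n.+2%:R^-1, n.+2%:R[%R -> 0 < x.
    by rewrite in_itv/= => /andP[+ _]; apply: lt_trans.
  have := @continuous_FTC2 R (fun x => a x - b x) F _ _ lt.
  have dF' x : x \in `]n.+2%:R^-1, n.+2%:R[%R -> derivable F x 1.
    by move=> /in0 /dF [].
  move=> /(_ _ _ _)/wrap[].
  - by apply: within_continuous_Rplus => // x x0; apply: cvgB; [exact: ca|exact: cb].
  - split => //.
    + by apply: cvg_at_right_filter; apply: is_derive1_continuous (dF _ n0).
    + by apply: cvg_at_left_filter; apply: is_derive1_continuous (dF _ _).
  - by move=> x /in0 /dF[_]; rewrite derive1E.
  under eq_integral do rewrite EFinB.
  rewrite integralB_EFin//=; [|exact: ia|exact: ia].
  rewrite [in X in _ -> X]EFinB => <-; rewrite subeK//.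
  by apply: integrable_fin_num; [exact: measurable_itv|exact: ia].
rewrite -(add0e (\int[mu]_(x in Rplus) (b x)%:E)%E) -(cvg_lim _ cva)//; apply/cvg_lim => //.
rewrite (_ : (fun n => _) = (fun n => (F n.+1%:R - F n.+1%:R^-1)%:E
  + \int[mu]_(x in `[(1 / n.+1%:R)%R, (1 * n.+1%:R)%R]) (b x)%:E)%E); last exact/funext.
by apply: cvgeD cvb; [exact: fin_num_adde_defr|apply: cvg_EFin cFu; exact: nearW].
Unshelve. all: by end_near. Qed.

(** These are the positive and negative parts of [g], in a form that visibly inherits continuity. *)
Lemma integral_Rplus_posneg g :
  (\int[mu]_(x in Rplus) (g x)%:E =
   \int[mu]_(x in Rplus) ((`|g x| + g x) / 2)%:E
   - \int[mu]_(x in Rplus) ((`|g x| - g x) / 2)%:E)%E.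
Proof.
rewrite integralE; congr (_ - _)%E; apply: eq_integral => x _.
  rewrite funeposE -EFin_max; congr EFin.
  by case: (lerP 0 (g x)) => g0; [rewrite ger0_norm//|rewrite ltr0_norm//]; lra.
rewrite funenegE -EFinN -EFin_max; congr EFin.
by rewrite maxEge oppr_ge0; case: (lerP (g x) 0) => g0;
  [rewrite ler0_norm//|rewrite gtr0_norm//]; lra.
Qed.

Lemma continuous_pos g (x : R) : {for x, continuous g} ->
  {for x, continuous (fun y => (`|g y| + g y) / 2)}.
Proof.
move=> cg; apply: cvgM; last exact: cvg_cst.
by apply: cvgD => //; apply: cvg_norm.
Qed.

Lemma continuous_neg g (x : R) : {for x, continuous g} ->
  {for x, continuous (fun y => (`|g y| - g y) / 2)}.
Proof.
move=> cg; apply: cvgM; last exact: cvg_cst.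
by apply: cvgB => //; apply: cvg_norm.
Qed.

Lemma pos_ge0 (y : R) : 0 <= (`|y| + y) / 2.
Proof. by have := ler_normlW (lexx `|- y|); rewrite normrN; lra. Qed.

Lemma neg_ge0 (y : R) : 0 <= (`|y| - y) / 2.
Proof. by have := ler_norm y; lra. Qed.

(** By [ge0_FTC_Rplus] the positive and negative parts of [g] have equal integrals; integrability
    makes them finite, so that their difference is 0. *)
Lemma FTC_Rplus F g :
  (forall x : R, 0 < x -> is_derive x 1 F (g x)) ->
  (forall x : R, 0 < x -> {for x, continuous g}) ->
  mu.-integrable Rplus (EFin \o g) ->
  F x @[x --> 0^'+] --> 0 -> F x @[x --> +oo%R] --> 0 ->
  \int[mu]_(x in Rplus) g x = 0.
Proof.
move=> dF cg ig F0 Foo; rewrite /Rintegral integral_Rplus_posneg.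
have ab : (\int[mu]_(x in Rplus) ((`|g x| + g x) / 2)%:E
    = \int[mu]_(x in Rplus) ((`|g x| - g x) / 2)%:E)%E.
  apply: (@ge0_FTC_Rplus F) => //.
  - by move=> x x0; apply: is_derive1_ext (dF _ x0) => //; lra.
  - by move=> x x0; apply: continuous_pos; exact: cg.
  - by move=> x x0; apply: continuous_neg; exact: cg.
  - by move=> x _; exact: pos_ge0.
  - by move=> x _; exact: neg_ge0.
have fin : (\int[mu]_(x in Rplus) (g x)%:E)%E \is a fin_num.
  by apply: integrable_fin_num => //; exact: measurable_Rplus.
rewrite integral_Rplus_posneg in fin.
rewrite ab subee//; move: fin; rewrite ab fin_numB => /andP[]//.
Qed.

Lemma ge0_integral_scale g (c : R) : 0 < c ->
  (forall x : R, 0 < x -> {for x, continuous g}) ->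
  (forall x : R, 0 < x -> 0 <= g x) ->
  (\int[mu]_(x in Rplus) (g (c * x) * c)%:E = \int[mu]_(x in Rplus) (g x)%:E)%E.
Proof.
move=> c0 cg g0.
have cgc (x : R) : 0 < x -> {for x, continuous (fun x => g (c * x) * c)}.
  move=> x0; apply: cvgM; last exact: cvg_cst.
  apply: (@continuous_comp _ _ _ (fun y => c * y) g).
    by apply: cvgM; [exact: cvg_cst|exact: cvg_id].
  by apply: cg; exact: mulr_gt0.
have cv1 := Rplus_exhaustion ltr01 ltr01 cgc _.
have cv2 := Rplus_exhaustion c0 c0 cg g0.
apply: (cvg_unique _ (cv1 _)) => //.
- by move=> x x0; rewrite mulr_ge0 ?g0 ?mulr_gt0// ltW.
- apply: cvg_trans cv2; apply: near_eq_cvg; near=> n.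
  have dF (x : R) : is_derive x 1 (fun y => c * y) c.
    by have := is_derive1Z c (is_derive_id x (1 : R)); rewrite mulr1.
  have dE : (fun y => c * y)^`()%classic = cst c.
    by apply/funext => x; rewrite derive1E; case: (dF x).
  have cF (x : R) : {for x, continuous (fun y => c * y)} by exact: is_derive1_continuous.
  have := @integration_by_substitution_increasing R (fun y => c * y) g
    (1 / n.+1%:R) (1 * n.+1%:R).
  rewrite !mul1r dE => ->.
  + by apply: eq_integral.
  + by rewrite (@le_trans _ _ 1)// ?invf_le1// ler1n.
  + by move=> x y _ _ xy; rewrite ltr_pM2l.
  + by move=> x _; exact: cst_continuous.
  + exact: is_cvg_cst.
  + exact: is_cvg_cst.
  + split; [by move=> x _; case: (dF x)|exact/cvg_at_right_filter/cF|].
    exact/cvg_at_left_filter/cF.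
  + by apply: within_continuous_Rplus => //; rewrite divr_gt0.
Unshelve. all: by end_near. Qed.

Lemma Rintegral_scale g (c : R) : 0 < c ->
  (forall x : R, 0 < x -> {for x, continuous g}) ->
  \int[mu]_(x in Rplus) (g (c * x) * c) = \int[mu]_(x in Rplus) g x.
Proof.
move=> c0 cg; rewrite /Rintegral [in RHS]integral_Rplus_posneg integral_Rplus_posneg.
congr fine; congr (_ - _)%E.
  rewrite -(@ge0_integral_scale (fun x => (`|g x| + g x) / 2) c)//.
  - by apply: eq_integral => x _; rewrite normrM (gtr0_norm c0); congr EFin; ring.
  - by move=> x x0; apply: continuous_pos; exact: cg.
  - by move=> x _; exact: pos_ge0.
rewrite -(@ge0_integral_scale (fun x => (`|g x| - g x) / 2) c)//.
- by apply: eq_integral => x _; rewrite normrM (gtr0_norm c0); congr EFin; ring.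
- by move=> x x0; apply: continuous_neg; exact: cg.
- by move=> x _; exact: neg_ge0.
Qed.

Lemma integrable_oneDsqrV (K : R) :
  mu.-integrable Rplus (fun x => (K * (oneDsqr x)^-1)%:E).
Proof.
rewrite (_ : (fun x => _) = (fun x => K%:E * (oneDsqr x)^-1%:E)%E); last first.
  by apply/funext => x; rewrite EFinM.
apply: integrableZl; first exact: measurable_Rplus.
apply: (@integrableS _ _ _ mu `[0%R, +oo[%classic).
- exact: measurable_itv.
- exact: measurable_Rplus.
- by rewrite RplusE; apply: subset_itvr; rewrite bnd_simp.
apply/integrableP; split.
  apply/measurable_EFinP; apply: (@measurable_funTS _ _ _ _ _ (fun x => (oneDsqr x)^-1)).
  by apply: continuous_measurable_fun => x; exact: continuous_oneDsqrV.
rewrite (_ : (\int[mu]_(x in _) _)%E =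
  (\int[mu]_(x in `[0%R, +oo[) ((oneDsqr x)^-1)%:E)%E); last first.
  by apply: eq_integral => x _; rewrite /= ger0_norm// invr_ge0;
    apply: le_trans (oneDsqr_ge1 _).
by rewrite integral0y_oneDsqr ltry.
Qed.

Lemma integrable_RplusZ f (k : R) : mu.-integrable Rplus (EFin \o f) ->
  mu.-integrable Rplus (EFin \o (fun x => k * f x)).
Proof.
move=> fi; rewrite (_ : EFin \o _ = fun x => k%:E * (f x)%:E)%E; last first.
  by apply/funext => x; rewrite /= EFinM.
by apply: integrableZl => //; exact: measurable_Rplus.
Qed.

Lemma integrable_RplusD f g : mu.-integrable Rplus (EFin \o f) ->
  mu.-integrable Rplus (EFin \o g) ->
  mu.-integrable Rplus (EFin \o (fun x => f x + g x)).
Proof.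
move=> fi gi; rewrite (_ : EFin \o _ = (EFin \o f) \+ (EFin \o g))%E; last first.
  by apply/funext => x; rewrite /= EFinD.
by apply: integrableD => //; exact: measurable_Rplus.
Qed.

Lemma integrable_decay f (K : R) :
  (forall x : R, 0 < x -> {for x, continuous f}) ->
  (forall x : R, 0 < x -> `|f x| <= K / oneDsqr x) ->
  mu.-integrable Rplus (EFin \o f).
Proof.
move=> cf fK; apply: le_integrable (integrable_oneDsqrV K).
- exact: measurable_Rplus.
- by apply/measurable_EFinP; exact: measurable_fun_Rplus.
- by move=> x /fK h; rewrite /= lee_fin; apply: le_trans h _; exact: ler_norm.
Qed.
End half_line.

(** * Bessel functions *)

Section decay.
Context {R : realType}.
Implicit Types F : R -> R.

Lemma cvg0_right F (K p : R) : 0 < p ->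
  (forall x, 0 < x -> x <= 1 -> `|F x| <= K * x `^ p) -> F x @[x --> 0^'+] --> 0.
Proof.
move=> p0 FK; apply/cvgr0Pnorm_le => e e0.
have /cvgr0Pnorm_le/(_ _ e0) : K * x `^ p @[x --> 0^'+] --> (0 : R).
  by rewrite -[X in _ --> X](mulr0 K); apply: cvgM; [exact: cvg_cst|exact: powR_cvg0].
move=> h; near=> x.
have hx : `|K * x `^ p| <= e by near: x.
apply: le_trans (FK x _ _) (le_trans (ler_norm _) hx).
- by near: x; exact: nbhs_right_gt.
- by near: x; exact: nbhs_right_le.
Unshelve. all: by end_near. Qed.

Lemma cvg0_pinfty F (K : R) :
  (forall x, 1 <= x -> `|F x| <= K / x) -> F x @[x --> +oo%R] --> 0.
Proof.
move=> FK; apply/cvgr0Pnorm_le => e e0.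
near=> x.
have x1 : 1 <= x by near: x; exact: nbhs_pinfty_ge.
apply: le_trans (FK x x1) _; rewrite ler_pdivrMr ?(lt_le_trans ltr01)//.
by rewrite mulrC -ler_pdivrMr//; near: x; exact: nbhs_pinfty_ge.
Unshelve. all: by end_near. Qed.
End decay.

(** * The recurrence of the Gamma function *)

Section gamma_function.
Context {R : realType}.
Implicit Types s : R.
Local Notation mu := (@lebesgue_measure R).

(** From ln y <= y - 1 at y = t / (2 s) one gets t^s exp(-t) <= (2 s)^s exp(-t/2), and exp(t/2) >=
    t/2. *)
Lemma powR_expRN_le s (t : R) : 0 < s -> 0 < t ->
  t `^ s * expR (- t) <= (2 * s) `^ s * 2 / t.
Proof.
move=> s0 t0.
have s20 : 0 < 2 * s by rewrite mulr_gt0.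
have ln1 : ln (t / (2 * s)) <= t / (2 * s) - 1.
  have h : 0 < t / (2 * s) by exact: divr_gt0.
  by have := @le_ln1Dx _ (t / (2 * s) - 1); rewrite subrKC; apply; lra.
rewrite lnM ?posrE ?invr_gt0// lnV ?posrE// in ln1.
have {}ln1 : s * ln t - t <= s * ln (2 * s) - t / 2.
  have : s * (ln t - ln (2 * s)) <= s * (t / (2 * s) - 1) by rewrite ler_pM2l.
  rewrite mulrBr mulrBr mulr1.
  have -> : s * (t / (2 * s)) = t / 2 by field; rewrite lt0r_neq0.
  lra.
rewrite /powR !gt_eqF// -expRD.
apply: le_trans (_ : expR (s * ln (2 * s) - t / 2) <= _); first by rewrite ler_expR.
rewrite expRD -mulrA ler_pM2l ?expR_gt0// expRN.
rewrite -[2 / t]invrK lef_pV2 ?posrE ?expR_gt0 ?invr_gt0 ?divr_gt0// invf_div.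
by apply: le_trans (expR_ge1Dx _); lra.
Qed.

Lemma Gamma_funS s : 0 < s -> Gamma_fun (s + 1) = s * Gamma_fun s.
Proof.
move=> s0; rewrite /Gamma_fun addrK.
have dexp (t : R) : is_derive t 1 (fun t => expR (- t)) (- expR (- t)).
  have := @is_derive1_scale R expR t (expR (-1 * t)) (-1) _.
  by rewrite !mulN1r; under eq_fun do rewrite mulN1r; apply; exact: is_derive_expR.
have dpow r (t : R) : 0 < t -> is_derive t 1 (fun t => t `^ r) (r * t `^ (r - 1)).
  exact: is_derive1_powR.
have cpow r (t : R) : 0 < t -> {for t, continuous (fun t => t `^ r * expR (- t))}.
  by move=> t0; have := is_derive1M (dpow r t t0) (dexp t); exact: is_derive1_continuous.
have key : (\int[mu]_(t in Rplus) (s * (t `^ (s - 1) * expR (- t)))%:E =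
            \int[mu]_(t in Rplus) (t `^ s * expR (- t))%:E)%E.
  apply: (@ge0_FTC_Rplus R (fun t => t `^ s * expR (- t))).
  - move=> t t0; apply: is_derive1_ext (is_derive1M (dpow s _ t0) (dexp t)) => //; ring.
  - by move=> t t0; apply: cvgM; [exact: cvg_cst|exact: cpow].
  - by move=> t t0; exact: cpow.
  - by move=> t t0; rewrite !mulr_ge0 ?powR_ge0 ?expR_ge0// ltW.
  - by move=> t t0; rewrite !mulr_ge0 ?powR_ge0 ?expR_ge0// ltW.
  - apply: (@cvg0_right R _ 1 s) => // x x0 _; rewrite mul1r.
    rewrite ger0_norm ?mulr_ge0 ?powR_ge0 ?expR_ge0//.
    by rewrite ler_piMr ?powR_ge0// -expR0 ler_expR oppr_le0 ltW.
  - apply: (@cvg0_pinfty R _ ((2 * s) `^ s * 2)) => x x1.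
    rewrite ger0_norm ?mulr_ge0 ?powR_ge0 ?expR_ge0//.
    by apply: powR_expRN_le => //; apply: lt_le_trans x1.
rewrite /Rintegral -key.
have -> : (\int[mu]_(t in Rplus) (s * (t `^ (s - 1) * expR (- t)))%:E =
    s%:E * \int[mu]_(t in Rplus) (t `^ (s - 1) * expR (- t))%:E)%E.
  under eq_integral do rewrite EFinM.
  apply: ge0_integralZl.
  - exact: measurable_Rplus.
  - by apply/measurable_EFinP; apply: measurable_fun_Rplus => x x0; exact: cpow.
  - by move=> x _; rewrite lee_fin mulr_ge0 ?powR_ge0 ?expR_ge0.
  - by rewrite lee_fin ltW.
have : (0 <= \int[mu]_(x in Rplus) (x `^ (s - 1) * expR (- x))%:E)%E.
  by apply: integral_ge0 => x _; rewrite lee_fin mulr_ge0 ?powR_ge0 ?expR_ge0.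
(* If the integral were infinite, [fine] would send both sides to 0, so the identity holds in that
   case too. *)
case: (\int[mu]_(x in Rplus) _)%E => //=.
by rewrite gt0_muley ?lte_fin//= mulr0.
Qed.

End gamma_function.

(** * The reduced Bessel function as a power series *)

Section bessel.
Context {R : realType}.
Implicit Types nu t z : R.

Lemma cvg_seriesZ (a : R^nat) (c l : R) : series a @ \oo --> l ->
  series (fun i => c * a i) @ \oo --> c * l.
Proof.
move=> al; rewrite (_ : series _ = fun n => c * series a n); first exact: cvgMr.
by apply/funext => n; rewrite /series/= mulr_sumr.
Qed.

Lemma cvg_seriesD (a b : R^nat) (l k : R) :
  series a @ \oo --> l -> series b @ \oo --> k ->
  series (fun i => a i + b i) @ \oo --> l + k.
Proof.
move=> al bk; rewrite (_ : series _ = fun n => series a n + series b n); first exact: cvgD.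
by apply/funext => n; rewrite /series/= big_split.
Qed.

(* Coefficients of the entire function [G_nu] with [J_nu z = z^nu G_nu (z^2)]. *)
Definition bessel_coef nu (k : nat) : R :=
  (-1) ^+ k / (k`!%:R * Gamma_fun (k%:R + nu + 1)) * 2^-1 `^ (2 * k%:R + nu).

Definition bessel_entire nu t : R := limn (pseries (bessel_coef nu) t).

(* [z^(-nu) J_nu z] *)
Definition bessel_reduced nu z : R := bessel_entire nu (z ^+ 2).

(** Coefficient form of G_nu' = - G_(nu+1) / 2: shifting k by one turns the Gamma factor into that
    of order nu + 1 and releases one sign and one factor 1/2. *)
Lemma bessel_coef_diffs nu :
  pseries_diffs (bessel_coef nu) = fun k => (- 2^-1) * bessel_coef (nu + 1) k.
Proof.
apply/funext => k; rewrite /pseries_diffs /bessel_coef.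
have -> : k.+1%:R + nu + 1 = k%:R + (nu + 1) + 1 :> R by rewrite -natr1; ring.
have -> : 2 * k.+1%:R + nu = (2 * k%:R + (nu + 1)) + 1 :> R by rewrite -natr1; ring.
rewrite (@powRD _ _ (2 * k%:R +
  (nu + 1)) 1) ?invr_eq0 ?pnatr_eq0 ?implybT// powRr1// factS natrM exprS.
rewrite !invfM.
set u := _ `^ _; set g := (Gamma_fun _)^-1; set f := (k`!%:R)^-1; set e := (-1) ^+ k.
by field; rewrite ?pnatr_eq0// -lt0n fact_gt0 nat1r pnatr_eq0.
Qed.

(** Coefficient form of 2 (nu + 1) G_(nu+1) + 2 t G_(nu+1)' = G_nu, the three-term recurrence of
    Bessel functions. It rests on Gamma(s + 1) = s Gamma(s) at s = k + nu + 1 >= 1/2. *)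
Lemma bessel_coef_order nu k : - 2^-1 <= nu ->
  (2 * (nu + 1)) * bessel_coef (nu + 1) k + 2 * (k%:R * bessel_coef (nu + 1) k)
  = bessel_coef nu k.
Proof.
move=> nu2; rewrite /bessel_coef.
have p0 : 0 < k%:R + nu + 1 by have : 0 <= k%:R :> R by []; lra.
have -> : k%:R + (nu + 1) + 1 = (k%:R + nu + 1) + 1 :> R by ring.
rewrite Gamma_funS//.
have -> : 2 * k%:R + (nu + 1) = (2 * k%:R + nu) + 1 :> R by ring.
rewrite powRD ?invr_eq0 ?pnatr_eq0 ?implybT// powRr1//.
rewrite !invfM; set u := _ `^ _; set g := (Gamma_fun _)^-1; set f := (k`!%:R)^-1; set e :=
  (-1) ^+ k.
have q : (k%:R + nu + 1) * (k%:R + nu + 1)^-1 = 1 by rewrite divff// gt_eqF.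
transitivity (e * f * g * u * ((k%:R + nu + 1) * (k%:R + nu + 1)^-1)); last by rewrite q;
  ring.
by field; rewrite gt_eqF.
Qed.

(** Both c_k and (k + 1) c_(k+1) are multiples of the same coefficient of order nu + 1, with factors
    2 (k + nu + 1) >= 1 and - 1/2. Hence (k + 1) |c_(k+1)| <= |c_k|, and the exponential series
    dominates. *)
Lemma bessel_coef_le nu k : - 2^-1 <= nu ->
  `|bessel_coef nu k| <= `|bessel_coef nu 0| / k`!%:R.
Proof.
move=> nu2; elim: k => [|k IH]; first by rewrite fact0 divr1.
have p1 : 2^-1 <= k%:R + nu + 1 by have : 0 <= k%:R :> R by []; lra.
have : k.+1%:R * bessel_coef nu k.+1 = - 2^-1 * bessel_coef (nu + 1) k.
  by have := bessel_coef_diffs nu; rewrite /pseries_diffs => /(congr1 (@^~ k)).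
have := bessel_coef_order k nu2.
set b := bessel_coef (nu + 1) k => bk bSk.
have le : `|bessel_coef nu k.+1| * k.+1%:R <= `|bessel_coef nu k|.
  rewrite -(normr_nat R k.+1) -normrM [_ * k.+1%:R]mulrC bSk -bk.
  rewrite (_ : _ + _ = (2 * (k%:R + nu + 1)) * b); last by ring.
  rewrite !normrM; apply: ler_wpM2r => //.
  rewrite normrN !ger0_norm//; lra.
rewrite factS natrM invfM mulrCA mulrC ler_pdivlMr//.
exact: le_trans IH.
Qed.

Lemma bessel_series_cvg nu t : - 2^-1 <= nu ->
  cvgn (pseries (bessel_coef nu) t).
Proof.
move=> nu2; apply: normed_cvg; apply: (@series_le_cvg _ _
  (fun k => `|bessel_coef nu 0| * exp_coeff `|t| k)).
- by move=> k; rewrite normr_ge0.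
- by move=> k; rewrite mulr_ge0// exp_coeff_ge0.
- move=> k; rewrite /= normrM normrX /exp_coeff/= mulrCA.
  by rewrite [leRHS]mulrC ler_wpM2r ?exprn_ge0// bessel_coef_le.
- apply/cvg_ex; eexists; apply: cvg_seriesZ; exact: is_cvg_series_exp_coeff.
Qed.

Lemma bessel_entire_cvg nu t : - 2^-1 <= nu ->
  series (fun k => bessel_coef nu k * t ^+ k) @ \oo --> bessel_entire nu t.
Proof. by move=> nu2; exact: bessel_series_cvg. Qed.

Lemma bessel_entire_diffs_cvg nu t : - 2^-1 <= nu ->
  series (fun k => pseries_diffs (bessel_coef nu) k * t ^+ k) @ \oo
    --> (- 2^-1 * bessel_entire (nu + 1) t).
Proof.
move=> nu2; rewrite bessel_coef_diffs.
under eq_fun do rewrite -mulrA.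
by apply: cvg_seriesZ; apply: bessel_entire_cvg; lra.
Qed.

Lemma is_derive_bessel_entire nu t : - 2^-1 <= nu ->
  is_derive t 1 (bessel_entire nu) (- 2^-1 * bessel_entire (nu + 1) t).
Proof.
move=> nu2.
have nu2' : - 2^-1 <= nu + 1 by lra.
rewrite -(cvg_lim _ (@bessel_entire_diffs_cvg nu t nu2))//.
apply: (@pseries_snd_diffs _ _ (`|t| + 1)).
- exact: bessel_series_cvg.
- by apply/cvg_ex; eexists; exact: bessel_entire_diffs_cvg.
- rewrite bessel_coef_diffs (_ : pseries_diffs _ =
    fun k => - 2^-1 * pseries_diffs (bessel_coef (nu + 1)) k); last first.
    by apply/funext => k; rewrite /pseries_diffs mulrCA.
  rewrite /pseries; under eq_fun do rewrite -mulrA.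
  apply/cvg_ex; eexists; apply: cvg_seriesZ; exact: bessel_entire_diffs_cvg.
- by rewrite [ltRHS]ger0_norm ?addr_ge0// ltrDl.
Qed.

Lemma bessel_entire_order nu t : - 2^-1 <= nu ->
  2 * (nu + 1) * bessel_entire (nu + 1) t - t * bessel_entire (nu + 2) t
  = bessel_entire nu t.
Proof.
move=> nu2.
have nu2' : - 2^-1 <= nu + 1 by lra.
have h := @bessel_entire_diffs_cvg _ t nu2'.
have {}h : series (fun i => i%:R * bessel_coef (nu + 1) i * t ^+ i.-1) @ \oo
    --> (- 2^-1 * bessel_entire (nu + 1 + 1) t).
  by rewrite -(cvg_lim _ h)//; apply: pseries_diffs_equiv; apply/cvg_ex; eexists; exact: h.
have := cvg_seriesD (@cvg_seriesZ _ (2 * (nu + 1)) _ (@bessel_entire_cvg _ t nu2'))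
  (@cvg_seriesZ _ (2 * t) _ h).
move=> /cvg_lim => /(_ (@norm_hausdorff _ _)) => e.
have -> : bessel_entire nu t = 2 * (nu + 1) * bessel_entire (nu + 1) t +
    2 * t * (- 2^-1 * bessel_entire (nu + 1 + 1) t).
  rewrite -e /bessel_entire; congr (lim (series _ @ \oo)); apply/funext => k.
  rewrite /= -(bessel_coef_order k nu2).
  (* At k = 0 the truncated exponent [i.-1] is harmless, because its coefficient is 0. *)
  by case: k => [|k]; [rewrite !mul0r !mulr0 !addr0; ring|rewrite exprS/=; ring].
by rewrite -addrA (_ : 1 + 1 = 2)//; field.
Qed.

Lemma besselJE nu z : - 2^-1 <= nu -> 0 < z ->
  besselJ nu z = z `^ nu * bessel_reduced nu z.
Proof.
move=> nu2 z0; rewrite /besselJ /bessel_reduced.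
have := @cvg_seriesZ _ (z `^ nu) _ (@bessel_entire_cvg _ (z ^+ 2) nu2).
move=> /cvg_lim => /(_ (@norm_hausdorff _ _)) <-.
congr (lim (series _ @ \oo)); apply/funext => k.
rewrite powRM ?invr_ge0 ?ltW// powRD ?(gt_eqF z0) ?implybT// /bessel_coef.
rewrite -natrM powR_mulrn ?ltW// exprM natrM; ring.
Qed.

Lemma is_derive_bessel_reduced nu z : - 2^-1 <= nu ->
  is_derive z 1 (bessel_reduced nu) (- z * bessel_reduced (nu + 1) z).
Proof.
move=> nu2.
have h : is_derive z 1 (bessel_reduced nu)
    (- 2^-1 * bessel_entire (nu + 1) (z ^+ 2) * (2 * z)).
  exact: (@is_derive1_compf R (bessel_entire nu) (fun x => x ^+
    2) z _ _ (is_derive_bessel_entire (z ^+ 2) nu2)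
    (is_derive_sqr z)).
by apply: (is_derive_eq h); rewrite /bessel_reduced; field.
Qed.

Lemma bessel_reduced_order nu z : - 2^-1 <= nu ->
  2 * (nu + 1) * bessel_reduced (nu + 1) z - z ^+ 2 * bessel_reduced (nu + 2) z
  = bessel_reduced nu z.
Proof. exact: bessel_entire_order. Qed.

(* With [j = bessel_reduced nu], the energy [j^2 + j'^2] is nonincreasing on the
   half line, by the equation [j'' + (2 nu + 1) j' / z + j = 0]. *)
Lemma bessel_reduced_le nu z : - 2^-1 <= nu -> 0 <= z ->
  `|bessel_reduced nu z| <= `|bessel_reduced nu 0|.
Proof.
move=> nu2 z0.
have nu2' : - 2^-1 <= nu + 1 by lra.
pose E z := bessel_reduced nu z * bessel_reduced nu z +
  (z * bessel_reduced (nu + 1) z) * (z * bessel_reduced (nu + 1) z).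
have dE (x : R) : is_derive x 1 E (- (2 * (2 * nu + 1)) * x * bessel_reduced (nu + 1) x ^+
  2).
  have d0 := is_derive_bessel_reduced x nu2.
  have d1 := @is_derive1M R id _ x _ _ (is_derive_id x 1) (is_derive_bessel_reduced x nu2').
  have h := is_derive1D (is_derive1M d0 d0) (is_derive1M d1 d1).
  apply: (is_derive_eq h).
  rewrite (_ : nu + 1 + 1 = nu + 2); last by ring.
  have := bessel_reduced_order x nu2.
  set j := bessel_reduced nu x; set j1 := bessel_reduced _ x; set j2 := bessel_reduced _ x.
  by move=> <-; ring.
have : E z <= E 0.
  apply: (@ler0_derive1_nincry _ E 0) => //.
  - move=> x; rewrite in_itv/= andbT => x0; rewrite derive1E; case: (dE x) => _ ->.
    have p : 0 <= 2 * (2 * nu + 1) by lra.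
    by rewrite !mulNr oppr_le0; exact: mulr_ge0 (mulr_ge0 p (ltW x0)) (sqr_ge0 _).
  - by apply: continuous_subspaceT => x; exact: is_derive1_continuous.
rewrite /E mul0r mulr0 addr0 => h.
rewrite -(@ler_pXn2r _ 2) ?nnegrE// !real_normK ?num_real// !expr2.
by apply: le_trans h; rewrite lerDl -expr2 sqr_ge0.
Qed.

End bessel.

(** * The Hankel transform of rapidly decreasing functions *)

Section chains.
Context {R : realType}.
Implicit Types (u v : nat -> R -> R) (M : nat -> nat -> R).

(* A smooth function is handled through the family of its iterated
   derivatives under [x^-1 D]. *)
Definition is_chain u := forall k (x : R), 0 < x -> is_derive x 1 (u k) (x * u k.+1 x).

Definition chain_bound M u := forall m k (x : R), 0 < x -> x ^+ m * `|u k x| <= M m k.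

Lemma is_chain_continuous u k (x : R) : is_chain u -> 0 < x -> {for x, continuous (u k)}.
Proof. by move=> cu x0; exact: is_derive1_continuous (cu k x x0). Qed.

(* The chain of [D^2 u + (2 nu + 1) / x D u]. *)
Definition bessel_op (nu : R) u k (x : R) :=
  (2 * nu + 2 + 2 * k%:R) * u k.+1 x + x ^+ 2 * u k.+2 x.

(** Applying x^-1 D to x^2 u_(k+2) releases 2 u_(k+2), so the operator keeps its shape while its
    constant grows by 2 at each step. *)
Lemma bessel_op_chain nu u : is_chain u -> is_chain (bessel_op nu u).
Proof.
move=> cu k x x0; rewrite /bessel_op.
have h := is_derive1D (is_derive1Z (2 * nu + 2 + 2 * k%:R) (cu k.+1 x x0))
  (is_derive1M (is_derive_sqr x) (cu k.+2 x x0)).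
by apply: (is_derive_eq h); rewrite -(natr1 k); ring.
Qed.

Lemma bessel_op_bound nu M u : chain_bound M u ->
  chain_bound (fun m k => `|2 * nu + 2 + 2 * k%:R| * M m k.+1 +
    M m.+2 k.+2) (bessel_op nu u).
Proof.
move=> bu m k x x0; rewrite /bessel_op.
have xm : 0 <= x ^+ m by rewrite exprn_ge0 ?(ltW x0).
apply: le_trans (ler_wpM2l xm (ler_normD _ _)) _.
rewrite mulrDr; apply: lerD.
  by rewrite normrM mulrCA ler_wpM2l// bu.
rewrite normrM (ger0_norm (sqr_ge0 x)) mulrA -exprD addn2; exact: bu.
Qed.

End chains.

(** * Smoothness and decay of the Hankel transform *)

Section hankel_transform.
Context {R : realType}.
Local Notation lambda := (@lebesgue_measure R).
Implicit Types (nu xi : R) (u : R -> R) (B : nat -> R).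

Definition rapid_decay B u :=
  (forall x : R, 0 < x -> {for x, continuous u}) /\
  (forall m (x : R), 0 < x -> x ^+ m * `|u x| <= B m).

(** The four exponents are those of (1 + x^2) (1 + x^n), where n = [(Num.truncn p).+1] exceeds p. *)
Definition decay_const B (p : R) : R :=
  B 0 + B 2 + B (Num.truncn p).+1 + B (Num.truncn p).+3.

Lemma powR_le1DX (x p : R) : 0 < x -> 0 <= p -> x `^ p <= 1 + x ^+ (Num.truncn p).+1.
Proof.
move=> x0 p0; have [x1|x1] := leP x 1.
  have : x `^ p <= 1 by rewrite -[leRHS](powRr0 x); apply: ger_powR => //; rewrite x0.
  have : 0 <= x ^+ (Num.truncn p).+1 by rewrite exprn_ge0 ?(ltW x0).
  lra.
have : x `^ p <= x ^+ (Num.truncn p).+1.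
  by rewrite -powR_mulrn ?(ltW x0)// ler_powR ?(ltW x1)// ltW// truncnS_gt.
lra.
Qed.

Lemma rapid_decay_le B u p (x : R) : rapid_decay B u -> 0 <= p -> 0 < x ->
  x `^ p * `|u x| <= decay_const B p / oneDsqr x.
Proof.
move=> [_ uB] p0 x0; rewrite ler_pdivlMr ?oneDsqr_gt0// /oneDsqr /decay_const.
have := ler_wpM2r (normr_ge0 (u x)) (powR_le1DX x0 p0).
set n := (Num.truncn p).+1 => h.
have := uB 0 x x0; have := uB 2 x x0; have := uB n x x0; have := uB n.+2 x x0.
rewrite expr0 -addn2 exprD.
have x20 : 0 <= 1 + x ^+ 2 by rewrite addr_ge0 ?sqr_ge0.
have := ler_wpM2r x20 h.
lra.
Qed.

(** This is xi^(-nu - 1/2) times the Hankel transform of order nu of x^(nu + 1/2) u(x). *)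
Definition hankel_reduced nu u xi : R :=
  \int[lambda]_(x in Rplus) (x `^ (2 * nu + 1) * u x * bessel_reduced nu (x * xi)).

Lemma bessel_reduced_continuous nu xi (x : R) : - 2^-1 <= nu ->
  {for x, continuous (fun x : R => bessel_reduced nu (x * xi))}.
Proof.
move=> nu2; rewrite (_ : (fun y : R => _) = fun y => bessel_reduced nu (xi * y));
  last first.
  by apply/funext => y; rewrite mulrC.
exact: is_derive1_continuous (is_derive1_scale (is_derive_bessel_reduced (xi * x) nu2)).
Qed.

Lemma powR_continuous (p x : R) : 0 < x -> {for x, continuous (fun x : R => x `^ p)}.
Proof. by move=> x0; exact: is_derive1_continuous (is_derive1_powR p x0). Qed.

Lemma hankel_integrand_continuous nu p xi u (x : R) : - 2^-1 <= nu -> 0 < x ->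
  {for x, continuous u} ->
  {for x, continuous (fun x : R => x `^ p * u x * bessel_reduced nu (x * xi))}.
Proof.
move=> nu2 x0 cu; apply: cvgM; last exact: bessel_reduced_continuous.
by apply: cvgM => //; exact: powR_continuous.
Qed.

Lemma hankel_integrand_le nu p xi u B (x : R) : - 2^-1 <= nu -> 0 <= xi -> 0 <= p ->
  rapid_decay B u -> 0 < x ->
  `|x `^ p * u x * bessel_reduced nu (x * xi)|
    <= `|bessel_reduced nu 0| * decay_const B p / oneDsqr x.
Proof.
move=> nu2 xi0 p0 du x0; rewrite 2!normrM (ger0_norm (powR_ge0 _ _)).
rewrite [leLHS]mulrC -[leRHS]mulrA; apply: ler_pM => //.
- by rewrite mulr_ge0 ?powR_ge0.
- by apply: bessel_reduced_le => //; rewrite mulr_ge0// ltW.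
- exact: rapid_decay_le.
Qed.

Lemma hankel_integrable nu p xi u B : - 2^-1 <= nu -> 0 <= xi -> 0 <= p ->
  rapid_decay B u ->
  lambda.-integrable Rplus
    (EFin \o (fun x => x `^ p * u x * bessel_reduced nu (x * xi))).
Proof.
move=> nu2 xi0 p0 du;
  apply: (@integrable_decay R _ (`|bessel_reduced nu 0| * decay_const B p)).
- by move=> x x0; apply: hankel_integrand_continuous => //; exact: du.1.
- by move=> x x0; exact: hankel_integrand_le.
Qed.

Lemma hankel_reduced_le nu xi u B : - 2^-1 <= nu -> 0 <= xi -> rapid_decay B u ->
  `|hankel_reduced nu u xi| <=
  \int[lambda]_(x in Rplus) (`|bessel_reduced nu 0| * decay_const B (2 * nu + 1) *
    (oneDsqr x)^-1).
Proof.
move=> nu2 xi0 du; have p0 : 0 <= 2 * nu + 1 by lra.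
have ih := hankel_integrable nu2 xi0 p0 du.
apply: le_trans (le_normr_Rintegral _ _) _.
- exact: measurable_Rplus.
- exact: ih.
apply: le_Rintegral.
- exact: measurable_Rplus.
- exact: integrable_norm.
- exact: integrable_oneDsqrV.
- by move=> x x0; apply: hankel_integrand_le.
Qed.

(** Differentiating the kernel in xi brings out - x^2 xi and raises the order of j by one; the
    factor x^2 turns the weight x^(2 nu + 1) into that of order nu + 1. *)
Lemma is_derive_hankel nu xi u B : - 2^-1 <= nu -> 0 < xi -> rapid_decay B u ->
  is_derive xi 1 (hankel_reduced nu u) (- xi * hankel_reduced (nu + 1) u xi).
Proof.
move=> nu2 xi0 du; have p0 : 0 <= 2 * nu + 1 by lra.
have nu2' : - 2^-1 <= nu + 1 by lra.
have p0' : 0 <= 2 * (nu + 1) + 1 by lra.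
pose f (xi : R) x := x `^ (2 * nu + 1) * u x * bessel_reduced nu (x * xi).
pose g (xi : R) x := - xi *
  (x `^ (2 * (nu + 1) + 1) * u x * bessel_reduced (nu + 1) (x * xi)).
have df (z x : R) : 0 < x -> is_derive z 1 (f ^~ x) (g z x).
  move=> x0; have h := is_derive1Z (x `^ (2 * nu + 1) * u x)
    (is_derive1_scale (is_derive_bessel_reduced (x * z) nu2)).
  apply: (is_derive_eq h); rewrite /g.
  rewrite (_ : 2 * (nu + 1) + 1 = 2 * nu + 1 + 2%:R); last by ring.
  rewrite (@powRD _ x (2 * nu + 1) 2%:R) ?(gt_eqF x0) ?implybT// powR_mulrn ?ltW//; ring.
(* The parameter will range over ]0, xi + 1[, which bounds the factor z in front of the derivative
   uniformly. *)
pose C := (xi + 1) * (`|bessel_reduced (nu + 1) 0| * decay_const B (2 * (nu + 1) + 1)).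
have xiI : `]0, (xi + 1)[%classic xi by rewrite /= in_itv/= xi0 ltrDl ltr01.
have I0 z : `]0, (xi + 1)[%classic z -> 0 < z by rewrite /= in_itv/= => /andP[].
have intf z : `]0, (xi + 1)[%classic z -> lambda.-integrable Rplus (EFin \o f z).
  by move=> /I0 z0; exact: hankel_integrable nu2 (ltW z0) p0 du.
have derf (z x : R) : `]0, (xi + 1)[%classic z -> Rplus x -> derivable (f ^~ x) z 1.
  by move=> _ x0; case: (df z x x0).
have C0 : 0 <= C.
  (* The estimate at x = 1 bounds an absolute value, which forces its constant to be nonnegative. *)
  have := hankel_integrand_le nu2' (ltW xi0) p0' du ltr01.
  move=> /(le_trans (normr_ge0 _)); rewrite pmulr_lge0 ?invr_gt0 ?oneDsqr_gt0// => h.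
  by rewrite /C mulr_ge0// addr_ge0// ltW.
have ubG (z x : R) : `]0, (xi + 1)[%classic z -> Rplus x ->
    `|partial1of2 f z x| <= C * (oneDsqr x)^-1.
  move=> zI x0; rewrite partial1of2E; case: (df z x x0) => _ ->.
  have z0 := I0 _ zI; move: zI; rewrite /= in_itv/= => /andP[_ z1].
  rewrite /g normrM normrN (gtr0_norm z0) /C -[leRHS]mulrA.
  apply: ler_pM; [exact: ltW|exact: normr_ge0|exact: ltW|].
  exact: hankel_integrand_le nu2' (ltW z0) p0' du x0.
have G0 (x : R) : 0 <= C * (oneDsqr x)^-1 by rewrite mulr_ge0 ?invr_ge0 ?oneDsqr_ge0.
split.
  exact: (@derivable_under_integral R _ _ lambda f Rplus measurable_Rplus xi 0 (xi + 1)
    xiI intf derf (fun x => C * (oneDsqr x)^-1) G0 (integrable_oneDsqrV C) ubG).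
rewrite -derive1E.
rewrite (@differentiation_under_integral R _ _ lambda f Rplus measurable_Rplus xi 0 (xi + 1)
    xiI intf derf (fun x => C * (oneDsqr x)^-1) G0 (integrable_oneDsqrV C) ubG).
rewrite /hankel_reduced -RintegralZl.
- apply: eq_Rintegral => x; rewrite inE => x0.
  by rewrite partial1of2E; case: (df xi x x0).
- exact: measurable_Rplus.
- exact: hankel_integrable nu2' (ltW xi0) p0' du.
Qed.

Lemma chain_rapid_decay M (v : nat -> R -> R) k : is_chain v -> chain_bound M v ->
  rapid_decay (M ^~ k) (v k).
Proof.
by move=> cv bv; split=> [x x0|m x x0]; [exact: is_chain_continuous|exact: bv].
Qed.

(* The integrand of the difference is the derivative of
   [x^(2 nu + 1) (u' j - u j')], where [j x = bessel_reduced nu (x xi)]. *)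
Lemma hankel_bessel_op nu xi M (v : nat -> R -> R) : - 2^-1 <= nu -> 0 < xi ->
  is_chain v -> chain_bound M v ->
  hankel_reduced nu (bessel_op nu v 0) xi = - xi ^+ 2 * hankel_reduced nu (v 0) xi.
Proof.
move=> nu2 xi0 cv bv; have p0 : 0 <= 2 * nu + 1 by lra.
have nu2' : - 2^-1 <= nu + 1 by lra.
have p2 : 0 < 2 * nu + 2 by lra.
have dv := chain_rapid_decay _ cv bv.
have dS := chain_rapid_decay 0 (bessel_op_chain nu cv) (bessel_op_bound nu bv).
have iS := hankel_integrable nu2 (ltW xi0) p0 dS.
have iv := hankel_integrable nu2 (ltW xi0) p0 (dv 0%N).
pose j (x : R) := bessel_reduced nu (x * xi).
pose j1 (x : R) := bessel_reduced (nu + 1) (x * xi).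
(* Here u' = x v_1 and j' = - x xi^2 j_1, so a factor x joins the weight x^(2 nu + 1). *)
pose F (x : R) := x `^ (2 * nu + 2) * (v 1%N x * j x + xi ^+ 2 * (v 0%N x * j1 x)).
pose g (x : R) := x `^ (2 * nu + 1) * bessel_op nu v 0 x * j x +
  xi ^+ 2 * (x `^ (2 * nu + 1) * v 0%N x * j x).
have ixiv : lambda.-integrable Rplus
    (EFin \o (fun x => xi ^+ 2 * (x `^ (2 * nu + 1) * v 0%N x * j x))).
  exact: integrable_RplusZ iv.
suff: \int[lambda]_(x in Rplus) g x = 0.
  rewrite RintegralD.
  - rewrite RintegralZl; [|exact: measurable_Rplus|exact: iv].
    by move=> /eqP; rewrite addr_eq0 => /eqP; rewrite mulNr.
  - exact: measurable_Rplus.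
  - exact: iS.
  - exact: ixiv.
apply: (@FTC_Rplus R F).
- move=> x x0; rewrite /F /g /bessel_op.
  have dj : is_derive x 1 j (xi * (- (x * xi) * j1 x)).
    have h := is_derive1_scale (is_derive_bessel_reduced (xi * x) nu2).
    rewrite (_ : j = fun y => bessel_reduced nu (xi * y)); last first.
      by apply/funext => y; rewrite /j mulrC.
    by apply: (is_derive_eq h); rewrite /j1 [xi * x]mulrC.
  have dj1 : is_derive x 1 j1 (xi * (- (x * xi) * bessel_reduced (nu + 2) (x * xi))).
    have h := is_derive1_scale (is_derive_bessel_reduced (xi * x) nu2').
    rewrite (_ : j1 = fun y => bessel_reduced (nu + 1) (xi * y)); last first.
      by apply/funext => y; rewrite /j1 mulrC.
    by apply: (is_derive_eq h); rewrite [xi * x]mulrC -addrA.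
  have h := is_derive1M (is_derive1_powR (2 * nu + 2) x0)
    (is_derive1D (is_derive1M (cv 1%N x x0) dj)
       (is_derive1Z (xi ^+ 2) (is_derive1M (cv 0%N x x0) dj1))).
  apply: (is_derive_eq h).
  have eorder := bessel_reduced_order (x * xi) nu2.
  rewrite -[2 * nu + 2 - 1]addrA (_ : 2 - 1 = 1); last by ring.
  rewrite (_ : 2 * nu + 2 = 2 * nu + 1 + 1); last by ring.
  rewrite (@powRD _ x (2 * nu + 1) 1) ?(gt_eqF x0) ?implybT// powRr1 ?ltW//.
  (* Writing j through the orders nu + 1 and nu + 2 turns the Bessel equation into a ring
     identity. *)
  have ej : j x = 2 * (nu + 1) * j1 x - (x * xi) ^+ 2 * bessel_reduced (nu + 2) (x * xi).
    by rewrite /j -eorder.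
  rewrite mulr0 addr0 ej; ring.
- move=> x x0; apply: cvgD.
    apply: hankel_integrand_continuous => //; exact: dS.1.
  apply: cvgM; first exact: cvg_cst.
  apply: hankel_integrand_continuous => //; exact: (dv 0%N).1.
- exact: integrable_RplusD iS ixiv.
- apply: (@cvg0_right R _ (M 0%N 1%N * `|bessel_reduced nu 0| +
    xi ^+ 2 * (M 0%N 0%N * `|bessel_reduced (nu + 1) 0|)) (2 * nu + 2)) => // x x0 _.
  rewrite normrM (ger0_norm (powR_ge0 _ _)) mulrC ler_wpM2r ?powR_ge0//.
  apply: le_trans (ler_normD _ _) _; apply: lerD.
    rewrite normrM; apply: ler_pM => //; first by have := bv 0%N 1%N x x0; rewrite mul1r.
    by apply: bessel_reduced_le => //; rewrite mulr_ge0// ltW.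
  rewrite normrM ger0_norm ?sqr_ge0// ler_wpM2l ?sqr_ge0// normrM; apply: ler_pM => //.
    by have := bv 0%N 0%N x x0; rewrite mul1r.
  by apply: bessel_reduced_le => //; rewrite mulr_ge0// ltW.
(* One power more than in [F], to leave a decay in 1/x. *)
- pose p := 2 * nu + 3.
  have p30 : 0 <= p by rewrite /p; lra.
  apply: (@cvg0_pinfty R _ (decay_const (M ^~ 1%N) p * `|bessel_reduced nu 0| +
    xi ^+ 2 * (decay_const (M ^~ 0%N) p * `|bessel_reduced (nu + 1) 0|))) => x x1.
  have x0 : 0 < x by exact: lt_le_trans x1.
  have le1 k : x `^ p * `|v k x| <= decay_const (M ^~ k) p.
    have h := rapid_decay_le (dv k) p30 x0.
    apply: le_trans (h) _; rewrite ler_piMr//;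
      last by rewrite invf_le1 ?oneDsqr_gt0 ?oneDsqr_ge1.
    move: h => /(le_trans (mulr_ge0 (powR_ge0 _ _) (normr_ge0 _))).
    by rewrite pmulr_lge0// invr_gt0 oneDsqr_gt0.
  rewrite ler_pdivlMr// mulrC /F normrM (ger0_norm (powR_ge0 _ _)) [leLHS]mulrA.
  have -> : x * x `^ (2 * nu + 2) = x `^ p.
    rewrite -[X in X * _](powRr1 (ltW x0)) -powRD ?(gt_eqF x0) ?implybT//.
    by congr (_ `^ _); rewrite /p; ring.
  apply: le_trans (ler_wpM2l (powR_ge0 _ _) (ler_normD _ _)) _.
  rewrite mulrDr; apply: lerD.
    rewrite normrM mulrA; apply: ler_pM => //; first by rewrite mulr_ge0 ?powR_ge0.
    by apply: bessel_reduced_le => //; rewrite mulr_ge0// ltW.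
  rewrite normrM ger0_norm ?sqr_ge0// mulrCA ler_wpM2l ?sqr_ge0// normrM mulrA;
    apply: ler_pM => //.
    by rewrite mulr_ge0 ?powR_ge0.
  by apply: bessel_reduced_le => //; rewrite mulr_ge0// ltW.
Qed.

Definition hankel_chain (mu : R) u k xi : R := (-1) ^+ k * hankel_reduced (mu + k%:R) u xi.

Lemma hankel_chainP mu u B : - 2^-1 <= mu -> rapid_decay B u ->
  is_chain (hankel_chain mu u).
Proof.
move=> mu2 du k xi xi0; rewrite /hankel_chain.
have nu2 : - 2^-1 <= mu + k%:R by have : 0 <= k%:R :> R by []; lra.
apply: (is_derive_eq (is_derive1Z _ (is_derive_hankel nu2 xi0 du))).
by rewrite -(natr1 k) addrA exprS; ring.
Qed.

(** Each factor xi^2 is traded for one use of the Bessel operator on the integrand, so the induction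
    must let the chain vary and reaches even powers only. *)
Lemma hankel_decay n nu M (v : nat -> R -> R) : - 2^-1 <= nu -> is_chain v ->
  chain_bound M v ->
  exists C, forall xi, 0 < xi -> xi ^+ (2 * n) * `|hankel_reduced nu (v 0%N) xi| <= C.
Proof.
move=> nu2; elim: n M v => [|n IH] M v cv bv.
  eexists => xi xi0; rewrite muln0 mul1r.
  exact: hankel_reduced_le nu2 (ltW xi0) (chain_rapid_decay 0 cv bv).
have [C HC] := IH _ _ (bessel_op_chain nu cv) (bessel_op_bound nu bv).
exists C => xi xi0; apply: le_trans (HC xi xi0).
rewrite (hankel_bessel_op nu2 xi0 cv bv) normrM mulnS addnC exprD -mulrA.
by rewrite normrN (ger0_norm (sqr_ge0 _)).
Qed.

Lemma hankel_chain_bound mu M (v : nat -> R -> R) : - 2^-1 <= mu ->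
  is_chain v -> chain_bound M v -> exists M', chain_bound M' (hankel_chain mu (v 0%N)).
Proof.
move=> mu2 cv bv.
suff /choice[M' M'P] : forall mk : nat * nat, exists C : R, forall xi, 0 < xi ->
    xi ^+ mk.1 * `|hankel_chain mu (v 0%N) mk.2 xi| <= C.
  by exists (fun m k => M' (m, k)) => m k xi; exact: (M'P (m, k)).
move=> [m k] /=.
have nu2 : - 2^-1 <= mu + k%:R by have : 0 <= k%:R :> R by []; lra.
have [C0 C0P] := hankel_decay 0 nu2 cv bv.
have [C1 C1P] := hankel_decay m nu2 cv bv.
exists (C0 + C1) => xi xi0.
rewrite /hankel_chain normrM normrX normrN1 expr1n mul1r.
set h := `|_|.
(* Odd powers follow from t <= 1 + t^2 with t = xi^m. *)
apply: le_trans (_ : (1 + xi ^+ (2 * m)) * h <= _).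
  rewrite ler_wpM2r// /h// mulnC exprM.
  by have := sqr_ge0 (xi ^+ m - 2^-1); nra.
rewrite mulrDl mul1r; apply: lerD; last exact: C1P.
by have := C0P xi xi0; rewrite muln0 mul1r.
Qed.

End hankel_transform.

(** * The space K_mu *)

Local Open Scope complex_scope.

Section smooth_functions.
Context {R : realType}.
Implicit Types f g : R -> R.

(** The derivative is any function that is correct on (0, oo). Products and restrictions to the half
    line are then handled by induction, with no formula for iterated [derive1]. *)
Fixpoint diff_Rplus (n : nat) f : Prop :=
  if n is n'.+1 then exists2 g,
    (forall x : R, 0 < x -> is_derive x 1 f (g x)) & diff_Rplus n' g
  else True.

Lemma diff_RplusW n f : diff_Rplus n.+1 f -> diff_Rplus n f.
Proof. by elim: n f => // n IH f [g fg /IH gn]; exists g. Qed.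

Lemma diff_Rplus_ext n f g : (forall x : R, 0 < x -> f x = g x) ->
  diff_Rplus n f -> diff_Rplus n g.
Proof.
case: n => // n fg [h fh hn]; exists h => // x x0.
exact: is_derive1_ext x0 fg erefl (fh x x0).
Qed.

Lemma diff_Rplus_add n f g : diff_Rplus n f -> diff_Rplus n g ->
  diff_Rplus n (fun x => f x + g x).
Proof.
elim: n f g => // n IH f g [f' ff' f'n] [g' gg' g'n].
exists (fun x => f' x + g' x); last exact: IH.
by move=> x x0; apply: is_derive1D; [exact: ff'|exact: gg'].
Qed.

Lemma diff_Rplus_mul n f g : diff_Rplus n f -> diff_Rplus n g ->
  diff_Rplus n (fun x => f x * g x).
Proof.
elim: n f g => // n IH f g [f' ff' f'n] [g' gg' g'n].
have fn : diff_Rplus n f by apply: diff_RplusW; exists f'.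
have gn : diff_Rplus n g by apply: diff_RplusW; exists g'.
exists (fun x => f' x * g x + f x * g' x); last by apply: diff_Rplus_add; exact: IH.
by move=> x x0; apply: is_derive1M; [exact: ff'|exact: gg'].
Qed.

Lemma diff_Rplus_powR n (c p : R) : diff_Rplus n (fun x => c * x `^ p).
Proof.
elim: n c p => // n IH c p; exists (fun x => (c * p) * x `^ (p - 1)); last exact: IH.
by move=> x x0; rewrite -mulrA; apply: is_derive1Z; exact: is_derive1_powR.
Qed.

Lemma diff_Rplus_inv n : diff_Rplus n (fun x => x^-1).
Proof.
apply: diff_Rplus_ext (diff_Rplus_powR n 1 (-1)) => x x0.
by rewrite mul1r powR_inv1 ?ltW.
Qed.

Lemma diff_Rplus_chain n (u : nat -> R -> R) k : is_chain u -> diff_Rplus n (u k).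
Proof.
move=> cu; elim: n k => // n IH k; exists (fun x => x * u k.+1 x); first by move=> x;
  exact: cu.
apply: diff_Rplus_mul => //; apply: diff_Rplus_ext (diff_Rplus_powR n 1 1) => x x0.
by rewrite mul1r powRr1 ?ltW.
Qed.

Lemma diff_Rplus_derive f : (forall n, diff_Rplus n f) ->
  (forall x : R, 0 < x -> derivable f x 1) /\ (forall n, diff_Rplus n (derive1 f)).
Proof.
move=> fn; split => [x x0|n].
  by have [g fg _] := fn 1%N; case: (fg x x0).
have [g fg gn] := fn n.+1; apply: diff_Rplus_ext gn => x x0.
by rewrite derive1E; case: (fg x x0).
Qed.

Lemma Re_iter_cderive1 (f : R -> R[i]) n :
  (fun y => complex.Re (iter n (@cderive1 R) f y)) =
    iter n (fun g => derive1 g) (fun y => complex.Re (f y)).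
Proof. by elim: n => //= n <-; apply/funext. Qed.

Lemma Im_iter_cderive1 (f : R -> R[i]) n :
  (fun y => complex.Im (iter n (@cderive1 R) f y)) =
    iter n (fun g => derive1 g) (fun y => complex.Im (f y)).
Proof. by elim: n => //= n <-; apply/funext. Qed.

Lemma smooth_iter_derive1 f : (forall n (x : R), 0 < x ->
  derivable (iter n (fun g => derive1 g) f) x 1) ->
  forall n, diff_Rplus n f.
Proof.
move=> df n; elim: n f df => // n IH f df; exists (derive1 f).
  by move=> x x0; split; [exact: (df 0%N)|rewrite derive1E].
by apply: IH => k x x0; rewrite -iterSr; exact: df.
Qed.

Lemma iter_derive1_smooth f : (forall n, diff_Rplus n f) ->
  forall n (x : R), 0 < x -> derivable (iter n (fun g => derive1 g) f) x 1.
Proof.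
move=> fn n; elim: n f fn => [|n IH] f fn x x0; first exact: (diff_Rplus_derive fn).1.
by rewrite iterSr; apply: IH => //; exact: (diff_Rplus_derive fn).2.
Qed.

Lemma smooth_RplusP (f : R -> R[i]) : smooth_Rplus f <->
  forall n, diff_Rplus n (fun y => complex.Re (f y)) /\
    diff_Rplus n (fun y => complex.Im (f y)).
Proof.
split=> [sf n|fn n x x0].
  split; apply: smooth_iter_derive1 => k x x0.
    by rewrite -Re_iter_cderive1; exact: (sf k x x0).1.
  by rewrite -Im_iter_cderive1; exact: (sf k x x0).2.
rewrite Re_iter_cderive1 Im_iter_cderive1.
by split; apply: iter_derive1_smooth => // k; have [] := fn k.
Qed.

End smooth_functions.

(** * Chains as coordinates on K_mu *)

Section Kmu_chains.
Context {R : realType}.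
Variable mu : R.
Implicit Types (phi psi : R -> R[i]) (M : nat -> nat -> R).

Lemma Re_mulRe (a : R) (z : R[i]) : complex.Re (a%:C * z) = a * complex.Re z.
Proof. by case: z => x y; rewrite /= mul0r subr0. Qed.

Lemma Im_mulRe (a : R) (z : R[i]) : complex.Im (a%:C * z) = a * complex.Im z.
Proof. by case: z => x y; rewrite /= mul0r addr0. Qed.

Lemma cabs_leD (z : R[i]) : cabs z <= `|complex.Re z| + `|complex.Im z|.
Proof.
case: z => a b; rewrite /cabs /=.
rewrite -(@ler_pXn2r _ 2) ?nnegrE ?sqrtr_ge0 ?addr_ge0// sqr_sqrtr ?addr_ge0 ?sqr_ge0//.
rewrite sqrrD !real_normK ?num_real// lerD2r lerDl.
by rewrite mulrn_wge0// mulr_ge0.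
Qed.

Lemma ler_Re_cabs (z : R[i]) : `|complex.Re z| <= cabs z.
Proof.
case: z => a b; rewrite /cabs /= -sqrtr_sqr ler_sqrt ?addr_ge0 ?sqr_ge0//.
by rewrite lerDl sqr_ge0.
Qed.

Lemma ler_Im_cabs (z : R[i]) : `|complex.Im z| <= cabs z.
Proof.
case: z => a b; rewrite /cabs /= -sqrtr_sqr ler_sqrt ?addr_ge0 ?sqr_ge0//.
by rewrite lerDr sqr_ge0.
Qed.

(* The bounded sets of [K_mu] are, up to inclusion, the sets [Kmu_disk M]. *)
Definition Kmu_disk M phi := exists a b,
  [/\ is_chain a, is_chain b, chain_bound M a, chain_bound M b &
    forall x : R, 0 < x -> phi x = (x `^ (mu + 2^-1))%:C * (a 0%N x +i* b 0%N x)].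

Lemma xinvD_chain phi (a b : nat -> R -> R) : is_chain a -> is_chain b ->
  (forall x : R, 0 < x -> phi x = (x `^ (mu + 2^-1))%:C * (a 0%N x +i* b 0%N x)) ->
  forall k (x : R), 0 < x ->
  iter k (@xinvD R) (fun y => (y `^ (- mu - 2^-1))%:C * phi y) x = a k x +i* b k x.
Proof.
move=> ca cb phiE; elim=> [|k IH] x x0 /=.
  rewrite phiE// mulrA -(rmorphM (real_complex R)).
  rewrite -powRD ?(gt_eqF x0) ?implybT// (_ : _ + _ = 0); last by ring.
  by rewrite powRr0 mul1r.
rewrite /xinvD /cderive1.
set F := iter k _ _ in IH *.
have dRe : derive1 (fun y => complex.Re (F y)) x = x * a k.+1 x.
  have h : is_derive x 1 (fun y => complex.Re (F y)) (x * a k.+1 x).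
    by apply: is_derive1_ext x0 _ erefl (ca k x x0) => y /IH ->.
  by rewrite derive1E; case: h.
have dIm : derive1 (fun y => complex.Im (F y)) x = x * b k.+1 x.
  have h : is_derive x 1 (fun y => complex.Im (F y)) (x * b k.+1 x).
    by apply: is_derive1_ext x0 _ erefl (cb k x x0) => y /IH ->.
  by rewrite derive1E; case: h.
apply/eqP; rewrite eq_complex Re_mulRe Im_mulRe /= dRe dIm.
by rewrite !mulKf ?(gt_eqF x0)// !eqxx.
Qed.

Lemma Kmu_disk_gamma_mk M phi m k : Kmu_disk M phi ->
  (gamma_mk mu m k phi <= (M m k + M m k)%:E)%E.
Proof.
move=> [a [b [ca cb Ma Mb phiE]]]; apply: ge_ereal_sup => _ [x x0 <-].
rewrite lee_fin (xinvD_chain ca cb phiE)//.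
apply: le_trans (cabs_leD _) _; rewrite Re_mulRe Im_mulRe/=.
by rewrite !normrM (ger0_norm (exprn_ge0 _ (ltW x0))); apply: lerD; [exact: Ma|exact: Mb].
Qed.

Lemma Kmu_disk_Kmu M phi : Kmu_disk M phi -> Kmu mu phi.
Proof.
move=> Mphi; split; last first.
  by move=> m k; apply: le_lt_trans (Kmu_disk_gamma_mk m k Mphi) _; exact: ltry.
case: Mphi => [a [b [ca cb _ _ phiE]]]; apply/smooth_RplusP => n; split.
  apply: diff_Rplus_ext (diff_Rplus_mul (diff_Rplus_powR n 1 (mu +
    2^-1)) (diff_Rplus_chain n 0 ca)) => x x0.
  by rewrite phiE// Re_mulRe/= mul1r.
apply: diff_Rplus_ext (diff_Rplus_mul (diff_Rplus_powR n 1 (mu +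
  2^-1)) (diff_Rplus_chain n 0 cb)) => x x0.
by rewrite phiE// Im_mulRe/= mul1r.
Qed.

Lemma diff_Rplus_xinvD (F : R -> R[i]) :
  (forall n, diff_Rplus n (fun y => complex.Re (F y)) /\
    diff_Rplus n (fun y => complex.Im (F y))) ->
  forall n, diff_Rplus n (fun y => complex.Re (xinvD F y)) /\
    diff_Rplus n (fun y => complex.Im (xinvD F y)).
Proof.
move=> dF n.
have [_ dR] := diff_Rplus_derive (fun n => (dF n).1).
have [_ dI] := diff_Rplus_derive (fun n => (dF n).2).
split.
  apply: diff_Rplus_ext (diff_Rplus_mul (diff_Rplus_inv n) (dR n)) => x _.
  by rewrite /xinvD Re_mulRe.
apply: diff_Rplus_ext (diff_Rplus_mul (diff_Rplus_inv n) (dI n)) => x _.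
by rewrite /xinvD Im_mulRe.
Qed.

Lemma Kmu_Kmu_disk phi : Kmu mu phi -> exists M, Kmu_disk M phi.
Proof.
move=> [sphi gphi].
pose F k := iter k (@xinvD R) (fun y => (y `^ (- mu - 2^-1))%:C * phi y).
have dF k n : diff_Rplus n (fun y => complex.Re (F k y)) /\
  diff_Rplus n (fun y => complex.Im (F k y)).
  elim: k n => [|k IH] n; last exact: diff_Rplus_xinvD.
  move/smooth_RplusP : sphi => /(_ n)[dR dI]; split.
    apply: diff_Rplus_ext (diff_Rplus_mul (diff_Rplus_powR n 1 (- mu - 2^-1)) dR) => x _.
    by rewrite /F/= Re_mulRe mul1r.
  apply: diff_Rplus_ext (diff_Rplus_mul (diff_Rplus_powR n 1 (- mu - 2^-1)) dI) => x _.
  by rewrite /F/= Im_mulRe mul1r.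
have bF m k (x : R) : 0 < x -> x ^+ m * cabs (F k x) <= fine (gamma_mk mu m k phi).
  move=> x0; rewrite -lee_fin fineK.
    apply: ereal_sup_ubound; exists x => //; congr EFin; rewrite /cabs.
    by rewrite ComplexField.Normc.normcM; congr (_ * _); rewrite /=
      expr0n addr0 sqrtr_sqr ger0_norm// exprn_ge0// ltW.
  rewrite fin_numE; apply/andP; split; last by rewrite -ltey; exact: gphi.
  (* The supremum is not -oo, being at least its nonnegative entry at x = 1. *)
  rewrite -ltNye; apply: lt_le_trans (ltNyr 0) _; apply: ereal_sup_ge.
  by exists (cabs ((1 ^+ m)%:C * F k 1))%:E; [exists 1 => //=;
    exact: ltr01|rewrite lee_fin /cabs; case: (_ * _) => ? ?; exact: sqrtr_ge0].
exists (fun m k => fine (gamma_mk mu m k phi)), (fun k x => complex.Re (F k x)),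
  (fun k x => complex.Im (F k x)).
split.
- move=> k x x0; have [dR _] := diff_Rplus_derive (fun n => (dF k n).1).
  by split; [exact: dR|rewrite -derive1E /F iterS [in RHS]/xinvD Re_mulRe /=
    mulVKf ?(gt_eqF x0)].
- move=> k x x0; have [dI _] := diff_Rplus_derive (fun n => (dF k n).2).
  by split; [exact: dI|rewrite -derive1E /F iterS [in RHS]/xinvD Im_mulRe /=
    mulVKf ?(gt_eqF x0)].
- move=> m k x x0; apply: le_trans (bF m k x x0).
  by rewrite ler_wpM2l ?ler_Re_cabs// exprn_ge0// ltW.
- move=> m k x x0; apply: le_trans (bF m k x x0).
  by rewrite ler_wpM2l ?ler_Im_cabs// exprn_ge0// ltW.
- move=> x x0; rewrite (_ : _ +i* _ = F 0%N x); last by case: (F 0%N x).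
  rewrite /F/= mulrA -(rmorphM (real_complex R)).
  rewrite -powRD ?(gt_eqF x0) ?implybT// (_ : _ + _ = 0); last by ring.
  by rewrite powRr0 mul1r.
Qed.

End Kmu_chains.

(** * Superposition of chains *)

Section weighted_sums.
Context {R : realType}.
Implicit Types (w c d : R^nat) (K W : R).

Definition weighted_sum w c : R := limn (series (fun i => w i * c i)).

Variables (w : R^nat) (W : R).
Hypothesis wW : forall n, \sum_(0 <= i < n) `|w i| <= W.

Lemma weights_cvg : cvgn (series (fun i => `|w i|)).
Proof.
apply: nondecreasing_is_cvgn.
  by apply/nondecreasing_seqP => n; rewrite /series/= big_nat_recr//= lerDl.
by exists W => _ [n _ <-]; exact: wW.
Qed.

Lemma weighted_sum_cvg c K : (forall i, `|c i| <= K) ->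
  series (fun i => w i * c i) @ \oo --> weighted_sum w c.
Proof.
move=> cK; apply: normed_cvg.
apply: (@series_le_cvg _ _ (fun i => K * `|w i|)).
- by move=> n; rewrite normr_ge0.
- by move=> n; rewrite mulr_ge0// (le_trans _ (cK n)).
- by move=> n; rewrite /= normrM mulrC ler_wpM2r.
- by apply/cvg_ex; eexists; apply: cvg_seriesZ; exact: weights_cvg.
Qed.

Lemma weighted_sumZ c K a : (forall i, `|c i| <= K) ->
  weighted_sum w (fun i => a * c i) = a * weighted_sum w c.
Proof.
move=> cK; have := @cvg_seriesZ _ _ a _ (@weighted_sum_cvg c K cK).
move=> /cvg_lim => /(_ (@norm_hausdorff _ _)) <-.
by congr (lim (series _ @ \oo)); apply/funext => i; rewrite mulrCA.
Qed.

Lemma weighted_sumD c d K : (forall i, `|c i| <= K) -> (forall i, `|d i| <= K) ->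
  weighted_sum w (fun i => c i + d i) = weighted_sum w c + weighted_sum w d.
Proof.
move=> cK dK; have := cvg_seriesD (@weighted_sum_cvg c K cK) (@weighted_sum_cvg d K dK).
move=> /cvg_lim => /(_ (@norm_hausdorff _ _)) <-.
by congr (lim (series _ @ \oo)); apply/funext => i; rewrite mulrDr.
Qed.

Lemma weighted_sum_le c K : (forall i, `|c i| <= K) -> `|weighted_sum w c| <= W * K.
Proof.
move=> cK.
have K0 : 0 <= K by exact: le_trans (cK 0%N).
have h n : `|series (fun i => w i * c i) n| <= W * K.
  apply: le_trans (ler_norm_sum _ _ _) _.
  apply: le_trans (_ : (\sum_(0 <= i < n) `|w i|) * K <= _); last exact: ler_wpM2r.
  by rewrite mulr_suml; apply: ler_sum => i _; rewrite normrM ler_wpM2l.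
have cv := @weighted_sum_cvg c K cK.
rewrite ler_norml; apply/andP; split.
  apply: limr_ge; first by apply/cvg_ex; eexists; exact: cv.
  by apply: nearW => n; have := h n; rewrite ler_norml => /andP[].
apply: limr_le; first by apply/cvg_ex; eexists; exact: cv.
by apply: nearW => n; have := h n; rewrite ler_norml => /andP[].
Qed.

(** The bound on [df] is asked only at points as close to [x] as [y] is, so that it may itself
    depend on |y - x|; [chain_taylor] uses this to gain a second factor. *)
Lemma derive_le_lipschitz (f df : R -> R) (x y K : R) : 0 < x -> 0 < y ->
  (forall t : R, 0 < t -> is_derive t 1 f (df t)) ->
  (forall t : R, 0 < t -> `|t - x| <= `|y - x| -> `|df t| <= K) ->
  `|f y - f x| <= K * `|y - x|.
Proof.
move=> x0 y0 dF dfK.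
wlog lt : / x != y.
  by have [->|xy] := eqVneq x y; [rewrite !subrr normr0 mulr0|apply].
have mvt a b : 0 < a -> a < b -> exists2 t, a < t < b & f b - f a = df t * (b - a).
  move=> a0 ab; have [] := @MVT R f df a b ab.
  - by move=> t; rewrite in_itv/= => /andP[at' _]; apply: dF; exact: lt_trans at'.
  - apply: within_continuous_Rplus => // t t0; exact: is_derive1_continuous (dF t t0).
  by move=> t tab e; exists t.
have [xy|yx] := ltP x y.
  have [t /andP[xt ty] ->] := mvt _ _ x0 xy.
  rewrite normrM ler_wpM2r// dfK//; first exact: lt_trans xt.
  by rewrite !gtr0_norm ?subr_gt0//; lra.
have {}yx : y < x by rewrite lt_neqAle yx eq_sym lt.
have [t /andP[yt tx] e] := mvt _ _ y0 yx.
rewrite distrC e normrM [X in _ * X]distrC ler_wpM2r// dfK//; first exact: lt_trans yt.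
by rewrite !ltr0_norm ?subr_lt0//; lra.
Qed.

(** A quadratic remainder with a common constant passes through infinite sums; this recovers the
    derivative from it. *)
Lemma quadratic_is_derive (f : R -> R) (x d K : R) : 0 < x ->
  (forall y, 0 < y -> `|f y - f x - (y - x) * d| <= K * `|y - x| * `|y - x|) ->
  is_derive x 1 f d.
Proof.
move=> x0 fK.
have cv : h^-1 *: ((f \o shift x) (h *: (1 : R)) - f x) @[h --> 0^'] --> d.
  apply/cvgrPdist_le => e e0; near=> h.
  have h0 : h != 0 by near: h; exact: nbhs_dnbhs_neq.
  have hx : `|h| < x by near: h; apply: dnbhs0_lt.
  have he : `|h| <= e / (`|K| + 1) by near: h; apply: dnbhs0_le;
    rewrite divr_gt0// ltr_wpDl.
  have y0 : 0 < h + x by move: hx; rewrite ltr_norml => /andP[]; lra.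
  have := fK _ y0; rewrite /= addrK /GRing.scale/= mulr1 => b.
  rewrite distrC (_ : _ - d = h^-1 * (f (h + x) - f x - h * d)); last by field.
  rewrite normrM normfV ler_pdivrMl ?normr_gt0//.
  apply: le_trans b _; rewrite mulrC ler_wpM2l//.
  apply: le_trans (_ : (`|K| + 1) * `|h| <= _).
    by rewrite ler_wpM2r//; have := ler_norm K; lra.
  by rewrite mulrC -ler_pdivlMr// ltr_wpDl.
split; first by apply/cvg_ex; exists d.
exact: cvg_lim cv.
Unshelve. all: by end_near. Qed.

(** The second derivative of u_k is u_(k+1) + x^2 u_(k+2), which [M] bounds on the whole half line.
    The mean value theorem is applied to the derivative, then to u_k minus its tangent part. *)
Lemma chain_taylor M (u : nat -> R -> R) k (x y : R) : is_chain u -> chain_bound M u ->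
  0 < x -> 0 < y ->
  `|u k y - u k x - (y - x) * (x * u k.+1 x)|
    <= (M 0%N k.+1 + M 2 k.+2) * `|y - x| * `|y - x|.
Proof.
move=> cu bu x0 y0.
have d1 (t : R) : 0 < t ->
  is_derive t 1 (fun t => t * u k.+1 t) (u k.+1 t + t ^+ 2 * u k.+2 t).
  move=> t0; have h := @is_derive1M R id _ t _ _ (is_derive_id t 1) (cu k.+1 t t0).
  by apply: (is_derive_eq h); ring.
have l1 (t : R) : 0 < t -> `|t * u k.+1 t - x * u k.+1 x| <= (M 0%N k.+1 + M 2 k.+2) *
  `|t - x|.
  move=> t0; apply: derive_le_lipschitz x0 t0 d1 _ => s s0 _.
  apply: le_trans (ler_normD _ _) _; apply: lerD.
    by have := bu 0%N k.+1 s s0; rewrite mul1r.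
  by rewrite normrM (ger0_norm (sqr_ge0 _)); exact: bu.
pose c := x * u k.+1 x.
have d2 (t : R) : 0 < t -> is_derive t 1 (fun t => u k t - c * t) (t * u k.+1 t - c).
  move=> t0; have h := is_derive1D (cu k t t0) (is_derive1Z (- c) (is_derive_id t 1)).
  rewrite (_ : (fun t => _) = fun t => u k t + (- c) * id t); last first.
    by apply/funext => s; rewrite mulNr.
  by apply: (is_derive_eq h); rewrite mulr1.
have C0 : 0 <= M 0%N k.+1 + M 2 k.+2.
  apply: addr_ge0; first by apply: le_trans (bu 0%N k.+1 x x0); rewrite mul1r.
  by apply: le_trans (bu 2 k.+2 x x0); rewrite mulr_ge0// sqr_ge0.
rewrite (_ : _ - _ = (u k y - c * y) - (u k x - c * x)); last by rewrite /c; ring.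
apply: derive_le_lipschitz x0 y0 d2 _ => t t0 ty.
by apply: le_trans (l1 t t0) _; rewrite ler_wpM2l.
Qed.

Lemma weighted_sum_chain M (a : nat -> nat -> R -> R) :
  (forall i, is_chain (a i)) -> (forall i, chain_bound M (a i)) ->
  is_chain (fun k x => weighted_sum w (fun i => a i k x)) /\
  chain_bound (fun m k => W * M m k) (fun k x => weighted_sum w (fun i => a i k x)).
Proof.
move=> ca ba.
have b0 k (x : R) : 0 < x -> forall i, `|a i k x| <= M 0%N k.
  by move=> x0 i; have := ba i 0%N k x x0; rewrite mul1r.
split=> [k x x0|m k x x0].
  apply: (@quadratic_is_derive _ _ _ (W * (M 0%N k.+1 + M 2 k.+2)) x0) => y y0.
  pose K := `|M 0%N k| + `|y - x| * (x * `|M 0%N k.+1|) + `|M 0%N k|.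
  have bK z : 0 < z -> forall i, `|a i k z| <= `|M 0%N k|.
    by move=> z0 i; apply: le_trans (b0 _ _ z0 i) (ler_norm _).
  have bK1 i : `|- (y - x) * (x * a i k.+1 x)| <= `|y - x| * (x * `|M 0%N k.+1|).
    rewrite normrM normrN ler_wpM2l// normrM gtr0_norm// ler_wpM2l ?(ltW x0)//.
    exact: le_trans (b0 _ _ x0 i) (ler_norm _).
  have K0 := normr_ge0 (M 0%N k).
  have K1 : 0 <= `|y - x| * (x * `|M 0%N k.+1|) by rewrite !mulr_ge0// ltW.
  have -> : weighted_sum w (fun i => a i k y) - weighted_sum w (fun i => a i k x)
      - (y - x) * (x * weighted_sum w (fun i => a i k.+1 x))
    = weighted_sum w (fun i => a i k y + (-1 * a i k x + - (y - x) * (x * a i k.+1 x))).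
    rewrite (@weighted_sumD _ _ (`|M 0%N k| + `|y - x| * (x * `|M 0%N k.+1|))).
    - rewrite (@weighted_sumD _ _ (`|M 0%N k| + `|y - x| * (x * `|M 0%N k.+1|))).
      + rewrite (@weighted_sumZ _ _ _ (bK _ x0)).
        rewrite (@weighted_sumZ (fun i => x * a i k.+1 x) (x * `|M 0%N k.+1|)); last first.
          move=> i; rewrite normrM gtr0_norm// ler_wpM2l ?(ltW x0)//.
          exact: le_trans (b0 _ _ x0 i) (ler_norm _).
        rewrite (@weighted_sumZ _ _ _ (b0 _ _ x0)); ring.
      + by move=> i; rewrite normrM normrN1 mul1r; have := bK _ x0 i; lra.
      + by move=> i; have := bK1 i; lra.
    - by move=> i; have := bK _ y0 i; lra.
    - move=> i; apply: le_trans (ler_normD _ _) _.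
      by rewrite mulN1r normrN; have := bK _ x0 i; have := bK1 i; lra.
  rewrite -!mulrA; apply: weighted_sum_le => i; rewrite mulrA.
  have := chain_taylor k (ca i) (ba i) x0 y0.
  by rewrite (_ : _ - _ - _ = a i k y + (-1 * a i k x + - (y - x) * (x * a i k.+1 x)));
    last by ring.
rewrite -(ger0_norm (exprn_ge0 m (ltW x0))) -normrM.
rewrite -(@weighted_sumZ _ _ _ (b0 k x x0)).
by apply: weighted_sum_le => i; rewrite normrM ger0_norm ?exprn_ge0 ?(ltW x0)//; exact: ba.
Qed.

End weighted_sums.

(** A tail is again a weighted sum, with its first n weights set to 0. Hence [weighted_sum_chain]
    bounds it by the small total weight that remains. *)
Lemma weighted_sum_tail {R : realType} (w c : R^nat) (W K : R) n :
  (forall n, \sum_(0 <= i < n) `|w i| <= W) -> (forall i, `|c i| <= K) ->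
  weighted_sum w c - \sum_(0 <= i < n) w i * c i
  = weighted_sum (fun i => if (i < n)%N then 0 else w i) c.
Proof.
move=> wW cK; apply/esym/cvg_lim => //.
have cs : (fun _ : nat => \sum_(0 <= i < n) w i * c i) @ \oo --> \sum_(0 <= i < n) w i *
  c i.
  exact: cvg_cst.
have h := cvgB (weighted_sum_cvg wW cK) cs.
suff e : {near \oo, (fun m => series (fun i => w i * c i) m - \sum_(0 <= i < n) w i * c i)
    =1 series (fun i => (if (i < n)%N then 0 else w i) * c i)}.
  exact: cvg_trans (near_eq_cvg e) (h _).
near=> m.
have nm : (n <= m)%N by near: m; exact: nbhs_infty_ge.
rewrite /series/= [in RHS](big_cat_nat _ nm)//=.
have -> : \sum_(0 <= i < n) (if (i < n)%N then 0 else w i) * c i = 0.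
  by rewrite big_nat; apply: big1 => i /andP[_ ->]; rewrite mul0r.
rewrite add0r (big_cat_nat _ nm)//= [X in X - _]addrC addrK.
by apply: eq_big_nat => i /andP[ni _]; rewrite ltnNge ni.
Unshelve. all: by end_near. Qed.

Section chain_operations.
Context {R : realType}.
Implicit Types (u v : nat -> R -> R) (M N : nat -> nat -> R) (c : R).

Lemma is_chainD u v : is_chain u -> is_chain v -> is_chain (fun k x => u k x + v k x).
Proof.
by move=> cu cv k x x0; rewrite mulrDr; apply: is_derive1D; [exact: cu|exact: cv].
Qed.

Lemma is_chainZ c u : is_chain u -> is_chain (fun k x => c * u k x).
Proof. by move=> cu k x x0; rewrite mulrCA; apply: is_derive1Z; exact: cu. Qed.

Lemma chain_boundD M N u v : chain_bound M u -> chain_bound N v ->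
  chain_bound (fun m k => M m k + N m k) (fun k x => u k x + v k x).
Proof.
move=> bu bv m k x x0.
apply: le_trans (ler_wpM2l (exprn_ge0 _ (ltW x0)) (ler_normD _ _)) _.
by rewrite mulrDr; apply: lerD; [exact: bu|exact: bv].
Qed.

Lemma chain_boundZ M c u : chain_bound M u ->
  chain_bound (fun m k => `|c| * M m k) (fun k x => c * u k x).
Proof. by move=> bu m k x x0; rewrite normrM mulrCA ler_wpM2l// bu. Qed.

Lemma chain_bound_comb M r c u v : chain_bound M u -> chain_bound M v ->
  chain_bound (fun m k => (`|r| + `|c|) * M m k) (fun k x => r * u k x + c * v k x).
Proof.
move=> bu bv m k x x0; rewrite mulrDl.
exact: (chain_boundD (chain_boundZ r bu) (chain_boundZ c bv)).
Qed.

(** Under x -> c x the operator x^-1 D picks up c^2. *)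
Lemma is_chain_scale c u : 0 < c -> is_chain u ->
  is_chain (fun k x => c ^+ (2 * k) * u k (c * x)).
Proof.
move=> c0 cu k x x0.
have h := is_derive1Z (c ^+ (2 * k)) (is_derive1_scale (cu k (c * x) (mulr_gt0 c0 x0))).
by apply: (is_derive_eq h); rewrite mulnS exprD; ring.
Qed.

Lemma chain_bound_scale M c u : 0 < c -> chain_bound M u ->
  chain_bound (fun m k => c ^+ (2 * k) / c ^+ m * M m k) (fun k x => c ^+ (2 * k) *
    u k (c * x)).
Proof.
move=> c0 bu m k x x0.
rewrite normrM (ger0_norm (exprn_ge0 _ (ltW c0))) mulrCA -mulrA.
rewrite ler_wpM2l ?exprn_ge0 ?(ltW c0)// ler_pdivlMl ?exprn_gt0// mulrA -exprMn.
exact: bu (mulr_gt0 c0 x0).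
Qed.

End chain_operations.

Section disk_operations.
Context {R : realType}.
Variable mu : R.
Implicit Types (phi psi : R -> R[i]) (M N : nat -> nat -> R).
Local Notation disk := (Kmu_disk mu).

Lemma Kmu_disk_ext M phi psi : (forall x : R, 0 < x -> phi x = psi x) -> disk M phi ->
  disk M psi.
Proof.
move=> pp [a [b [ca cb Ma Mb phiE]]]; exists a, b; split=> // x x0.
by rewrite -pp// phiE.
Qed.

Lemma Kmu_disk_mono M N phi : (forall m k, M m k <= N m k) -> disk M phi -> disk N phi.
Proof.
move=> MN [a [b [ca cb Ma Mb phiE]]]; exists a, b; split=> // m k x x0.
  exact: le_trans (Ma m k x x0) _.
exact: le_trans (Mb m k x x0) _.
Qed.

Lemma Kmu_disk0 : disk (fun _ _ => 0) (fun=> 0).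
Proof.
have c0 : is_chain (fun (_ : nat) (_ : R) => 0 : R).
  by move=> k x x0; rewrite mulr0; exact: is_derive_cst.
have b0 : chain_bound (fun _ _ => 0) (fun (_ : nat) (_ : R) => 0 : R).
  by move=> m k x x0; rewrite normr0 mulr0.
by exists (fun _ _ => 0), (fun _ _ => 0); split => // x _; rewrite mulr0.
Qed.

Lemma Kmu_diskZ (s : R) M phi : disk M phi ->
  disk (fun m k => `|s| * M m k) (fun x => s%:C * phi x).
Proof.
move=> [a [b [ca cb Ma Mb phiE]]].
exists (fun k x => s * a k x), (fun k x => s * b k x); split.
- exact: is_chainZ.
- exact: is_chainZ.
- exact: chain_boundZ.
- exact: chain_boundZ.
- move=> x x0; rewrite phiE// mulrCA; congr (_ * _).
  by apply/eqP; rewrite eq_complex Re_mulRe Im_mulRe/= !eqxx.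
Qed.

Lemma Kmu_disk_lin (z : R[i]) M N phi psi : disk M phi -> disk N psi ->
  disk (fun m k => (`|complex.Re z| + `|complex.Im z|) * M m k + N m k)
    (fun x => z * phi x + psi x).
Proof.
case: z => r s.
move=> [a [b [ca cb Ma Mb phiE]]] [a' [b' [ca' cb' Na' Nb' psiE]]].
exists (fun k x => (r * a k x + (- s) * b k x) + a' k x),
  (fun k x => (s * a k x + r * b k x) + b' k x); split.
- by apply: is_chainD => //; apply: is_chainD; exact: is_chainZ.
- by apply: is_chainD => //; apply: is_chainD; exact: is_chainZ.
- by apply: chain_boundD => //=; rewrite -(normrN s); exact: chain_bound_comb.
- by apply: chain_boundD => //=; rewrite [`|r| + _]addrC; exact: chain_bound_comb.
- move=> x x0; rewrite phiE// psiE// mulrCA -mulrDr; congr (_ * _).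
  by apply/eqP; rewrite eq_complex /= mulNr !eqxx/= ![_ + _ * a 0%N x]addrC eqxx.
Qed.

Lemma Kmu_disk_scale (c : R) M phi : 0 < c -> disk M phi ->
  disk (fun m k => `|c `^ (mu + 2^-1)| * (c ^+ (2 * k) / c ^+ m * M m k)) (fun x =>
    phi (c * x)).
Proof.
move=> c0 [a [b [ca cb Ma Mb phiE]]].
apply: (@Kmu_disk_ext _ (fun x => (c `^ (mu + 2^-1))%:C * ((x `^ (mu + 2^-1))%:C *
  (a 0%N (c * x) +i* b 0%N (c * x))))).
  move=> x x0; rewrite phiE ?mulr_gt0// mulrA powRM ?(ltW c0) ?(ltW x0)//.
  by rewrite (rmorphM (real_complex R)).
apply: Kmu_diskZ.
exists (fun k x => c ^+ (2 * k) * a k (c * x)), (fun k x => c ^+ (2 * k) * b k (c * x));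
  split.
- exact: is_chain_scale.
- exact: is_chain_scale.
- exact: chain_bound_scale.
- exact: chain_bound_scale.
- by move=> x x0; rewrite muln0 !mul1r.
Qed.

Lemma Kmu_lin (z : R[i]) phi psi : Kmu mu phi -> Kmu mu psi ->
  Kmu mu (fun x => z * phi x + psi x).
Proof.
move=> /Kmu_Kmu_disk[M Mphi] /Kmu_Kmu_disk[N Npsi].
exact: Kmu_disk_Kmu (Kmu_disk_lin z Mphi Npsi).
Qed.

Lemma Kmu0 : Kmu mu (fun=> 0). Proof. exact: Kmu_disk_Kmu Kmu_disk0. Qed.

Lemma gamma_r_lt M (r : nat) (K : R) phi : disk M phi -> 0 < K ->
  (forall m k, (m < r.+1)%N -> (k < r.+1)%N -> M m k + M m k < K) ->
  (gamma_r mu r phi < K%:E)%E.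
Proof.
move=> Mphi K0 MK; rewrite /gamma_r; apply: bigmax_lt => [|m _]; first by rewrite lte_fin.
apply: bigmax_lt => [|k _]; first by rewrite lte_fin.
by apply: le_lt_trans (Kmu_disk_gamma_mk m k Mphi) _; rewrite lte_fin; exact: MK.
Qed.

End disk_operations.

(** * Functionals on bounded sets *)

Section duality.
Context {R : realType}.
Variable mu : R.
Implicit Types (phi psi : R -> R[i]) (M N : nat -> nat -> R).
Local Notation disk := (Kmu_disk mu).

Lemma cabsM (y z : R[i]) : cabs (y * z) = cabs y * cabs z.
Proof. exact: ComplexField.Normc.normcM. Qed.

Lemma cabsN (z : R[i]) : cabs (- z) = cabs z.
Proof. by case: z => a b; rewrite /cabs/= !sqrrN. Qed.

Lemma cabs_ge0 (z : R[i]) : 0 <= cabs z.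
Proof. by case: z => a b; exact: sqrtr_ge0. Qed.

Lemma cabs_real (a : R) : cabs a%:C = `|a|.
Proof. by rewrite /cabs /= expr0n addr0 sqrtr_sqr. Qed.

Lemma cabsD (y z : R[i]) : cabs (y + z) <= cabs y + cabs z.
Proof. exact: le_normcD. Qed.

Variable F : (R -> R[i]) -> R[i].
Hypothesis dF : Kmu_dual mu F.

Lemma Kmu_dual0 : F (fun=> 0) = 0.
Proof.
have := dF.1 1 _ _ (Kmu0 mu) (Kmu0 mu).
rewrite (_ : (fun _ => _) = fun=> 0); last by apply/funext => x; rewrite mulr0 addr0.
by rewrite mul1r => /eqP; rewrite eq_sym -subr_eq0 addrK => /eqP.
Qed.

Lemma Kmu_dualZ (z : R[i]) phi : Kmu mu phi -> F (fun x => z * phi x) = z * F phi.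
Proof.
move=> Kphi; have := dF.1 z _ _ Kphi (Kmu0 mu).
rewrite Kmu_dual0 addr0 => <-; congr F.
by apply/funext => x; rewrite addr0.
Qed.

(** The difference lies in the disk of zero bounds, hence in every neighbourhood of 0. This is
    needed because the transform is computed only at positive arguments. *)
Lemma Kmu_dual_ext phi psi : Kmu mu phi -> (forall x : R, 0 < x -> phi x = psi x) ->
  F phi = F psi.
Proof.
move=> Kphi pp; have [M Mphi] := Kmu_Kmu_disk Kphi.
have Kpsi : Kmu mu psi := Kmu_disk_Kmu (Kmu_disk_ext pp Mphi).
apply/eqP; rewrite -subr_eq0; apply/eqP.
apply: ComplexField.Normc.eq0_normc; apply/eqP; rewrite eq_le cabs_ge0 andbT.
apply/ler_addgt0Pl => e e0; rewrite addr0.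
have [r [d [d0 dFd]]] := dF.2 _ Kpsi _ e0.
apply: ltW; apply: dFd => //; apply: (@gamma_r_lt _ _ (fun _ _ => 0)) => //.
  apply: Kmu_disk_ext (Kmu_disk0 mu) => x x0; by rewrite pp// subrr.
by move=> m k _ _; rewrite addr0.
Qed.

Lemma Kmu_dual_bounded M : exists S : R, forall psi, disk M psi -> cabs (F psi) <= S.
Proof.
have [r [d [d0 dFd]]] := dF.2 _ (Kmu0 mu) _ (@ltr01 R).
pose K := 1 + \sum_(m < r.+1) \sum_(k < r.+1) `|M m k|.
have K0 : 0 < K by rewrite ltr_pwDl// sumr_ge0// => m _; rewrite sumr_ge0.
have MK m k : (m < r.+1)%N -> (k < r.+1)%N -> `|M m k| < K.
  move=> mr kr; rewrite /K (bigD1 (Ordinal mr))//= (bigD1 (Ordinal kr))//=.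
  have h1 : 0 <= \sum_(i < r.+1 | i != Ordinal kr) `|M m i| by rewrite sumr_ge0.
  have h2 : 0 <= \sum_(i < r.+1 | i != Ordinal mr) \sum_(j < r.+1) `|M i j|.
    by rewrite sumr_ge0// => i _; rewrite sumr_ge0.
  lra.
(* Scaling by [s] moves the disk into the neighbourhood where |F| < 1; the 2 accounts for real and
   imaginary parts. *)
pose s := d / (2 * K).
have s0 : 0 < s by rewrite divr_gt0// mulr_gt0.
exists s^-1 => psi Mpsi.
have Kpsi := Kmu_disk_Kmu Mpsi.
have /dFd : Kmu mu (fun x => s%:C * psi x) := Kmu_disk_Kmu (Kmu_diskZ s Mpsi).
rewrite Kmu_dual0 subr0 Kmu_dualZ// cabsM cabs_real (gtr0_norm s0) => h.
rewrite -[leRHS]mulr1 ler_pdivlMl//; apply: ltW; apply: h.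
apply: gamma_r_lt (d0) _.
  apply: Kmu_disk_ext (Kmu_diskZ s Mpsi) => x x0; by rewrite subr0.
move=> m k mr kr; rewrite (gtr0_norm s0) -mulrDr /s.
rewrite mulrAC ltr_pdivrMr ?mulr_gt0// ltr_pM2l//.
by have := MK m k mr kr; have := ler_norm (M m k); lra.
Qed.

End duality.

(** * Uniform boundedness *)

Section uniform_boundedness.
Context {R : realType}.
Variable mu : R.
Implicit Types (phi psi : R -> R[i]).
Local Notation disk := (Kmu_disk mu).

Let third n : R := 3^-1 ^+ n.

Let third_gt0 n : 0 < third n. Proof. by rewrite exprn_gt0// invr_gt0. Qed.

(** The part of the sum from k to n - 1 equals 3/2 (3^-k - 3^-n); [maxn] also covers n <= k in the
    induction. *)
Lemma geometric_tail_sum (w : R^nat) k : (forall i, `|w i| = third i) ->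
  forall n, \sum_(0 <= i < n) `|if (i < k)%N then 0 else w i| <= 3 / 2 * third k.
Proof.
move=> wE n.
suff : \sum_(0 <= i < n) `|if (i < k)%N then 0 else w i| <= 3 / 2 *
  (third k - third (maxn k n)).
  by move/le_trans; apply; rewrite ler_wpM2l// gerBl ltW.
elim: n => [|n IH]; first by rewrite big_nil maxn0 subrr mulr0.
rewrite big_nat_recr//=; case: ltnP => nk.
  by rewrite normr0 addr0 (maxn_idPl nk); move: IH; rewrite (maxn_idPl (ltnW nk)).
rewrite wE (maxn_idPr (leqW nk)); move: IH; rewrite (maxn_idPr nk).
by rewrite /third exprS; lra.
Qed.

(** This stands in for completeness of K_mu: the series converges to an element, with every
    remainder in an explicit multiple of the disk. *)
Lemma Kmu_superposition M (psi : nat -> R -> R[i]) (w : R^nat) :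
  (forall i, disk M (psi i)) -> (forall i, `|w i| = third i) ->
  exists phi, forall k, disk (fun m j => 3 / 2 * third k * M m j)
    (fun x => phi x - \sum_(0 <= i < k) (w i)%:C * psi i x).
Proof.
move=> Mpsi wE; have [a aP] := choice Mpsi; have [b bP] := choice aP.
have ca i : is_chain (a i) by have [] := bP i.
have cb i : is_chain (b i) by have [] := bP i.
have Ma i : chain_bound M (a i) by have [] := bP i.
have Mb i : chain_bound M (b i) by have [] := bP i.
have psiE i (x : R) : 0 < x -> psi i x = (x `^ (mu + 2^-1))%:C * (a i 0%N x +i* b i 0%N x).
  by have [_ _ _ _] := bP i; exact.
have wW k := geometric_tail_sum k wE.
have wW0 n : \sum_(0 <= i < n) `|w i| <= 3 / 2 * third 0 by exact: wW 0%N n.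
exists (fun x => (x `^ (mu + 2^-1))%:C *
  (weighted_sum w (fun i => a i 0%N x) +i* weighted_sum w (fun i => b i 0%N x))) => k.
have [ca' Ma'] := weighted_sum_chain (wW k) ca Ma.
have [cb' Mb'] := weighted_sum_chain (wW k) cb Mb.
set w' := fun i => if (i < k)%N then 0 else w i in ca' Ma' cb' Mb'.
exists (fun j x => weighted_sum w' (fun i => a i j x)),
  (fun j x => weighted_sum w' (fun i => b i j x)).
split => // x x0.
have ba i : `|a i 0%N x| <= M 0%N 0%N by have := Ma i 0%N 0%N x x0; rewrite mul1r.
have bb i : `|b i 0%N x| <= M 0%N 0%N by have := Mb i 0%N 0%N x x0; rewrite mul1r.
rewrite -(weighted_sum_tail k wW0 ba) -(weighted_sum_tail k wW0 bb).
rewrite (eq_bigr (fun i => (x `^ (mu + 2^-1))%:C *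
  (w i * a i 0%N x +i* (w i * b i 0%N x)))); last first.
  move=> i _; rewrite psiE// mulrCA; congr (_ * _).
  by apply/eqP; rewrite eq_complex Re_mulRe Im_mulRe/= !eqxx.
rewrite -mulr_sumr -mulrBr; congr (_ * _).
apply/eqP; rewrite eq_complex !raddfB/= !raddf_sum/=.
by rewrite !eqxx.
Qed.

(* Sokal's argument: for linear [F] one of [F (x + y)] and [F (x - y)] is at
   least as large as [F y], so the signs in a series [sum (+-) 3^-k psi_k], with
   [psi_k] nearly maximizing [F k] on the disk, can be chosen one at a time. *)
Lemma uniform_boundedness M (F : nat -> (R -> R[i]) -> R[i]) (t : R^nat) :
  (forall k (s : R) phi psi, Kmu mu phi -> Kmu mu psi ->
     F k (fun x => s%:C * phi x + psi x) = s%:C * F k phi + F k psi) ->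
  (forall k N, exists S : R, forall psi, disk N psi -> cabs (F k psi) <= S) ->
  (forall k, 0 < t k) ->
  (forall k, exists2 psi, disk M psi & 4 ^+ k * t k <= cabs (F k psi)) ->
  exists2 phi, Kmu mu phi & forall k, 4^-1 * (4 / 3) ^+ k * t k <= cabs (F k phi).
Proof.
move=> Flin Fbd t0 Fbig.
pose E k : set R := [set cabs (F k psi) | psi in disk M].
have supE k : has_sup (E k).
  split; first by have [psi Mpsi _] := Fbig k; exists (cabs (F k psi)), psi.
  by have [S SP] := Fbd k M; exists S => _ [psi Mpsi <-]; exact: SP.
have Ele k psi : disk M psi -> cabs (F k psi) <= sup (E k).
  by move=> Mpsi; apply: ub_le_sup; [exact: (supE k).2|exists psi].
have Ege k : 4 ^+ k * t k <= sup (E k).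
  by have [psi Mpsi h] := Fbig k; apply: le_trans h _; exact: Ele.
have Egt0 k : 0 < sup (E k) by apply: lt_le_trans (Ege k); rewrite mulr_gt0// exprn_gt0.
have /choice[psi psiP] k : exists psi, disk M psi /\ 3 / 4 * sup (E k) <= cabs (F k psi).
  have e0 : 0 < sup (E k) / 4 by rewrite divr_gt0.
  have [_ [psi Mpsi <-] h] := sup_adherent e0 (supE k).
  by exists psi; split => //; lra.
have Mpsi k := (psiP k).1.
pose next k (p : R -> R[i]) (s : R) := fun x => (s * third k)%:C * psi k x + p x.
pose sgn k p : R := if third k * cabs (F k (psi k)) <=
  cabs (F k (next k p 1)) then 1 else -1.
pose partial := fix partial k :=
  if k is k'.+1 then next k' (partial k') (sgn k' (partial k')) else (fun=> 0).
pose w k := sgn k (partial k) * third k.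
have wE k : `|w k| = third k.
  by rewrite /w normrM (ger0_norm (ltW (third_gt0 k))) /sgn; case: ifP;
    rewrite ?normrN1 ?normr1 mul1r.
have partialE k x : partial k x = \sum_(0 <= i < k) (w i)%:C * psi i x.
  by elim: k => [|k IH]; [rewrite big_nil|rewrite big_nat_recr//= -IH addrC].
have Kpartial k : Kmu mu (partial k).
  by elim: k => [|k IH]; [exact: Kmu0|apply: Kmu_lin => //; exact: Kmu_disk_Kmu (Mpsi k)].
have [phi phiP] := Kmu_superposition Mpsi wE.
exists phi.
  apply: Kmu_disk_Kmu (Kmu_disk_ext _ (phiP 0%N)) => x x0.
  by rewrite big_nil subr0.
move=> k.
have Kpsi : Kmu mu (psi k) := Kmu_disk_Kmu (Mpsi k).
have step : third k * cabs (F k (psi k)) <= cabs (F k (partial k.+1)).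
  rewrite /= /sgn; case: ifP => // /negbT; rewrite -ltNge => h.
  move: h; rewrite /next !Flin// => h.
  have := cabsD ((1 * third k)%:C * F k (psi k) + F k (partial k))
     (- ((-1 * third k)%:C * F k (psi k) + F k (partial k))).
  rewrite cabsN opprD addrACA subrr addr0 -mulrBl -(raddfB (real_complex R)).
  rewrite cabsM cabs_real (_ : 1 * third k - -1 * third k = 2 * third k); last by ring.
  rewrite (ger0_norm _); last by rewrite mulr_ge0// ltW.
  lra.
pose rest x := phi x - partial k.+1 x.
have diskrest : disk (fun m j => 3 / 2 * third k.+1 * M m j) rest.
  by apply: Kmu_disk_ext (phiP k.+1) => x x0; rewrite /rest partialE.
have Krest := Kmu_disk_Kmu diskrest.
have third2 : 0 < 3 / 2 * third k.+1 by rewrite mulr_gt0.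
(* The remainder lies in 3/2 3^-(k+1) = 3^-k / 2 times the disk, where |F k| is at most that
   multiple of the supremum. *)
have Frest : cabs (F k rest) <= 2^-1 * third k * sup (E k).
  have : disk M (fun x => (3 / 2 * third k.+1)^-1%:C * rest x).
    apply: Kmu_disk_mono (Kmu_diskZ (3 / 2 * third k.+1)^-1 diskrest) => m j.
    by rewrite gtr0_norm ?invr_gt0// mulKf// gt_eqF.
  move=> /(Ele k).
  have := Flin k (3 / 2 * third k.+1)^-1 _ _ Krest (Kmu0 mu).
  have F0 : F k (fun=> 0) = 0.
    have := Flin k 1 _ _ (Kmu0 mu) (Kmu0 mu).
    rewrite (_ : (fun _ => _) = fun=> 0); last by apply/funext => x; rewrite mulr0 addr0.
    by rewrite mul1r => /eqP; rewrite eq_sym -subr_eq0 addrK => /eqP.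
  rewrite F0 addr0 (_ : (fun x => _ + _) = fun x => (3 / 2 * third k.+1)^-1%:C * rest x);
    last first.
    by apply/funext => x; rewrite addr0.
  move=> ->; rewrite cabsM cabs_real gtr0_norm ?invr_gt0// ler_pdivrMl//.
  by move=> /le_trans; apply; rewrite /third exprS; lra.
have Fphi : F k phi = F k (partial k.+1) + F k rest.
  have := Flin k 1 _ _ (Kpartial k.+1) Krest; rewrite mul1r => <-; congr F.
  by apply/funext => x; rewrite mul1r /rest addrC subrK.
have := cabsD (F k phi) (- F k rest); rewrite cabsN Fphi addrK => h.
have h2 := (psiP k).2; have h3 := Ege k.
have h4 := ler_wpM2l (ltW (third_gt0 k)) h2.
have h5 := ler_wpM2l (ltW (third_gt0 k)) h3.
(* The chosen term gives at least 3/4 3^-k sup and the rest takes at most 1/2 3^-k sup. The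
   remaining quarter, with sup >= 4^k t_k, is the claim. *)
have e : (4 / 3) ^+ k = third k * 4 ^+ k by rewrite exprMn mulrC.
rewrite e -mulrA -[_ * _ * t k]mulrA.
move: h5; set z := third k * (4 ^+ k * t k); lra.
Qed.

End uniform_boundedness.

(** * The fractional Hankel transform *)

Section chirp.
Context {R : realType}.
Variable mu : R.
Implicit Types (M : nat -> nat -> R) (a b : nat -> R -> R).
Local Notation disk := (Kmu_disk mu).

(* Conjugation by the chirp [cis (c x^2 / 2)] turns [x^-1 D] into [i c + x^-1 D],
   whose action on the chain of [a + i b] this is. *)
Definition chirp_step (c : R) (ab : (nat -> R -> R) * (nat -> R -> R)) :=
  ((fun k x => - c * ab.2 k x + ab.1 k.+1 x), (fun k x => c * ab.1 k x + ab.2 k.+1 x)).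

Definition chirp_bound_step (A : R) M m k := A * M m k + M m k.+1.

Lemma chirp_step_chain c a b n : is_chain a -> is_chain b ->
  is_chain (iter n (chirp_step c) (a, b)).1 /\ is_chain (iter n (chirp_step c) (a, b)).2.
Proof.
move=> ca cb; elim: n => //= n [c1 c2].
split; (apply: is_chainD; first exact: is_chainZ) => k x x0; [exact: c1|exact: c2].
Qed.

Lemma chirp_step_bound A M c a b n : `|c| <= A -> chain_bound M a -> chain_bound M b ->
  chain_bound (iter n (chirp_bound_step A) M) (iter n (chirp_step c) (a, b)).1 /\
  chain_bound (iter n (chirp_bound_step A) M) (iter n (chirp_step c) (a, b)).2.
Proof.
move=> cA Ma Mb; elim: n => //= n [b1 b2].
set N := iter n _ M in b1 b2 *.
have weak d u v : `|d| <= A -> chain_bound N u -> chain_bound N v ->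
    chain_bound (chirp_bound_step A N) (fun k x => d * u k x + v k.+1 x).
  move=> dA Nu Nv m k x x0.
  apply: le_trans (ler_wpM2l (exprn_ge0 _ (ltW x0)) (ler_normD _ _)) _.
  rewrite mulrDr; apply: lerD; last exact: Nv.
  rewrite normrM mulrCA; apply: ler_pM => //; last exact: Nu.
  by rewrite mulr_ge0// exprn_ge0// ltW.
by split; apply: weak => //; rewrite normrN.
Qed.

(** [N] is independent of both [c] and [phi]: this uniformity puts all the Phi_e in one disk. *)
Lemma Kmu_disk_chirp A M : exists N, forall (c : R) phi, `|c| <= A -> disk M phi ->
  disk N (fun x => cis (c * x ^+ 2 / 2) * phi x).
Proof.
exists (fun m k => iter k (chirp_bound_step A) M m 0%N +
  iter k (chirp_bound_step A) M m 0%N).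
move=> c phi cA [a [b [ca cb Ma Mb phiE]]].
(* The k-th member of the new chain is the chirp times the entry of index 0 of the pair stepped k
   times. *)
pose p k := (iter k (chirp_step c) (a, b)).1.
pose q k := (iter k (chirp_step c) (a, b)).2.
have cp k : is_chain (p k) by exact: (chirp_step_chain c k ca cb).1.
have cq k : is_chain (q k) by exact: (chirp_step_chain c k ca cb).2.
have bp k := (chirp_step_bound k cA Ma Mb).1.
have bq k := (chirp_step_bound k cA Ma Mb).2.
pose th (x : R) := c * x ^+ 2 / 2.
have dth (x : R) : is_derive x 1 th (c * x).
  have h := is_derive1Z (c / 2) (is_derive_sqr x).
  rewrite (_ : th = fun y => c / 2 * y ^+ 2); last by apply/funext => y; rewrite /th; ring.
  by apply: (is_derive_eq h); field.
have dcos (x : R) : is_derive x 1 (fun y => cos (th y)) (- sin (th x) * (c * x)).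
  exact: is_derive1_compf (is_derive_cos (th x)) (dth x).
have dsin (x : R) : is_derive x 1 (fun y => sin (th y)) (cos (th x) * (c * x)).
  exact: is_derive1_compf (is_derive_sin (th x)) (dth x).
have bnd m k (x r s : R) : 0 < x -> `|r| <= 1 -> `|s| <= 1 ->
    x ^+ m * `|r * p k 0%N x + s * q k 0%N x| <=
    iter k (chirp_bound_step A) M m 0%N + iter k (chirp_bound_step A) M m 0%N.
  move=> x0 r1 s1.
  apply: le_trans (ler_wpM2l (exprn_ge0 _ (ltW x0)) (ler_normD _ _)) _.
  rewrite mulrDr !normrM; apply: lerD.
    apply: le_trans (bp k m 0%N x x0); rewrite ler_wpM2l ?exprn_ge0 ?(ltW x0)//.
    by rewrite ler_piMl.
  apply: le_trans (bq k m 0%N x x0); rewrite ler_wpM2l ?exprn_ge0 ?(ltW x0)//.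
  by rewrite ler_piMl.
have cos1 (t : R) : `|cos t| <= 1 by rewrite ler_norml cos_geN1 cos_le1.
have sin1 (t : R) : `|sin t| <= 1 by rewrite ler_norml sin_geN1 sin_le1.
exists (fun k x => cos (th x) * p k 0%N x + - sin (th x) * q k 0%N x).
exists (fun k x => sin (th x) * p k 0%N x + cos (th x) * q k 0%N x); split.
- move=> k x x0.
  have h := is_derive1D (is_derive1M (dcos x) (cp k 0%N x x0))
    (is_derive1M (is_derive1Z (-1) (dsin x)) (cq k 0%N x x0)).
  apply: is_derive1_ext x0 _ _ h => [y _|]; first by rewrite mulN1r.
  by rewrite /p /q /=; ring.
- move=> k x x0.
  have h := is_derive1D (is_derive1M (dsin x) (cp k 0%N x x0))
    (is_derive1M (dcos x) (cq k 0%N x x0)).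
  apply: (is_derive_eq h).
  by rewrite /p /q /=; ring.
- by move=> m k x x0; apply: bnd => //; rewrite normrN.
- by move=> m k x x0; exact: bnd.
- move=> x x0; rewrite phiE// mulrCA; congr (_ * _).
  by apply/eqP; rewrite eq_complex /cis /th /= mulNr eqxx/= addrC.
Qed.

End chirp.

(** * Uniformity over dilations *)

Section dilation.
Context {R : realType}.
Variable mu : R.
Variable F : (R -> R[i]) -> R[i].
Hypothesis dF : Kmu_dual mu F.
Implicit Types (phi psi : R -> R[i]) (M : nat -> nat -> R) (e s : R).

Lemma Kmu_disk_div e M : 0 < e -> exists N, forall phi, Kmu_disk mu M phi ->
  Kmu_disk mu N (fun x => phi (x / e)).
Proof.
move=> e0; have ei0 : 0 < e^-1 by rewrite invr_gt0.
eexists => phi Mphi.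
rewrite (_ : (fun x => _) = fun x => phi (e^-1 * x)); last first.
  by apply/funext => x; rewrite mulrC.
exact: Kmu_disk_scale ei0 Mphi.
Qed.

Lemma dilate_lin e s phi psi : 0 < e -> Kmu mu phi -> Kmu mu psi ->
  dilate e F (fun x => s%:C * phi x + psi x) = s%:C * dilate e F phi + dilate e F psi.
Proof.
move=> e0 Kphi Kpsi; rewrite /dilate.
have Kdiv chi : Kmu mu chi -> Kmu mu (fun x => chi (x / e)).
  move=> /Kmu_Kmu_disk[M Mchi]; have [N NP] := Kmu_disk_div M e0.
  exact: Kmu_disk_Kmu (NP _ Mchi).
rewrite (dF.1 s%:C _ _ (Kdiv _ Kphi) (Kdiv _ Kpsi)).
by rewrite mulrDr mulrCA.
Qed.

Lemma dilate_bounded e M : 0 < e ->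
  exists S : R, forall psi, Kmu_disk mu M psi -> cabs (dilate e F psi) <= S.
Proof.
move=> e0; have [N NP] := Kmu_disk_div M e0; have [S SP] := Kmu_dual_bounded dF N.
exists (e^-1 * S) => psi Mpsi; rewrite /dilate cabsM cabs_real gtr0_norm ?invr_gt0//.
by rewrite ler_wpM2l ?invr_ge0 ?(ltW e0)//; exact/SP/NP.
Qed.

(** If the bound fails, the sequence [e] is fixed before any test function. The resonant [phi] built
    for it is then the only one whose constant and threshold are consulted. *)
Lemma quasi_asymp_bounded0_disk (m : R) (L : R -> R) M :
  (forall x, 0 < x -> 0 < L x) -> quasi_asymp_bounded0 mu m L F ->
  forall Phi : R -> R -> R[i], (forall e, 0 < e -> e <= 1 -> Kmu_disk mu M (Phi e)) ->
  exists C : R, 0 < C /\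
    \forall e \near 0^'+, cabs (dilate e F (Phi e)) <= C * (e `^ m * L e).
Proof.
move=> L0 qb Phi MPhi; apply: contrapT => nC.
have H0 e : 0 < e -> 0 < e `^ m * L e by move=> e0; rewrite mulr_gt0 ?powR_gt0 ?L0.
(* The conclusion fails in particular for the constant 4^k, at points as small as desired. *)
have /choice[e eP] k : exists e : R, [/\ 0 < e, e <= k.+1%:R^-1 &
    4 ^+ k * (e `^ m * L e) <= cabs (dilate e F (Phi e))].
  apply: contrapT => ne; apply: nC; exists (4 ^+ k); split; first by rewrite exprn_gt0.
  near=> e; rewrite leNgt; apply/negP => h; apply: ne; exists e; split.
  - by near: e; exact: nbhs_right_gt.
  - by near: e; apply: nbhs_right_le; rewrite invr_gt0.
  - exact: ltW.
have e0 k : 0 < e k by have [] := eP k.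
have MPhie k : exists2 psi, Kmu_disk mu M psi &
    4 ^+ k * (e k `^ m * L (e k)) <= cabs (dilate (e k) F psi).
  have [ek0 ek1 h] := eP k; exists (Phi (e k)) => //; apply: MPhi => //.
  by apply: le_trans ek1 _; rewrite invf_le1// ler1n.
have [phi Kphi phiP] := @uniform_boundedness R mu M (fun k => dilate (e k) F)
  (fun k => e k `^ m * L (e k)) (fun k s phi psi => @dilate_lin _ s phi psi (e0 k))
  (fun k N => dilate_bounded N (e0 k)) (fun k => H0 _ (e0 k)) MPhie.
have [C [C0 [d /= d0 dP]]] := qb _ Kphi.
(* At this k the point e_k is below the threshold d, so (4/3)^k <= 4 C; but 3 (4/3)^k >= k + 3 while
   12 C < k + 1. *)
pose k := (Num.truncn (12 * C) + Num.truncn d^-1)%N.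
have kC : 12 * C < k.+1%:R.
  by apply: lt_le_trans (truncnS_gt _) _; rewrite ler_nat ltnS leq_addr.
have kd : k.+1%:R^-1 < d.
  rewrite invf_plt ?posrE//; apply: lt_le_trans (truncnS_gt _) _.
  by rewrite ler_nat ltnS leq_addl.
have pow n : n%:R + 3 <= 3 * (4 / 3) ^+ n :> R.
  elim: n => [|n IH]; first by rewrite expr0; lra.
  rewrite -natr1 exprS; have : 0 <= n%:R :> R by [].
  lra.
have [ek0 ek1 _] := eP k.
have := dP (e k); rewrite /ball_/= sub0r normrN gtr0_norm// =>
  /(_ (le_lt_trans ek1 kd) ek0).
move=> /(le_trans (phiP k)); rewrite ler_pM2r ?H0// => h.
by have := pow k; move: kC; rewrite -natr1; lra.
Unshelve. all: by end_near. Qed.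

End dilation.

(** * Reduction to the ordinary Hankel transform *)

Section hankel_of_dilates.
Context {R : realType}.
Variables mu alpha : R.
Hypotheses (mu2 : - 2^-1 <= mu) (halpha : 0 < alpha < pi).
Local Notation lambda := (@lebesgue_measure R).
Implicit Types phi : R -> R[i].

Lemma csc_gt0 : 0 < csc alpha.
Proof. by rewrite /csc invr_gt0; exact: sin_gt0_pi. Qed.

Lemma cisD (s t : R) : cis (s + t) = cis s * cis t.
Proof.
rewrite /cis cosD sinD; apply/eqP; rewrite eq_complex /= eqxx/=.
by rewrite addrC.
Qed.

Lemma sqrt_besselJ (z : R) : 0 < z ->
  Num.sqrt z * besselJ mu z = z `^ (mu + 2^-1) * bessel_reduced mu z.
Proof.
move=> z0; rewrite besselJE// mulrA -powR12_sqrt ?(ltW z0)//.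
by rewrite -powRD ?(gt_eqF z0) ?implybT// addrC.
Qed.

(** The measure x^(2 mu + 1) dx is homogeneous of degree 2 mu + 2. *)
Lemma hankel_reduced_scale u B (e eta : R) : 0 < e -> 0 < eta -> rapid_decay B u ->
  hankel_reduced mu (fun x => u (e * x)) eta
  = e `^ (- (2 * mu + 2)) * hankel_reduced mu u (eta / e).
Proof.
move=> e0 eta0 du; have e0' := gt_eqF e0.
have em : e != 0 by rewrite e0'.
pose g (x : R) := e `^ (- (2 * mu + 2)) *
  (x `^ (2 * mu + 1) * u x * bessel_reduced mu (x * (eta / e))).
have cg (x : R) : 0 < x -> {for x, continuous g}.
  move=> x0; apply: cvgM; first exact: cvg_cst.
  by apply: hankel_integrand_continuous => //; exact: du.1.
rewrite /hankel_reduced -RintegralZl; [|exact: measurable_Rplus|].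
rewrite -(Rintegral_scale e0 cg); apply: eq_Rintegral => x; rewrite inE => x0.
rewrite /g powRM ?(ltW e0) ?(ltW x0)// powRN.
rewrite (_ : 2 * mu + 2 = 2 * mu + 1 + 1); last by ring.
rewrite (@powRD _ e (2 * mu + 1) 1) ?e0' ?implybT// powRr1 ?(ltW e0)//.
rewrite (_ : e * x * (eta / e) = x * eta); last by field.
by field; rewrite em gt_eqF ?powR_gt0.
have p0 : 0 <= 2 * mu + 1 by move: mu2; lra.
by apply: hankel_integrable du => //; rewrite divr_ge0 ?(ltW e0) ?(ltW eta0).
Qed.

Lemma cintegral_RplusZ (z : R[i]) (r s : R -> R) :
  lambda.-integrable Rplus (EFin \o r) -> lambda.-integrable Rplus (EFin \o s) ->
  cintegral_Rplus (fun x => z * (r x +i* s x)) =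
  z * (\int[lambda]_(x in Rplus) r x +i* \int[lambda]_(x in Rplus) s x).
Proof.
case: z => a b ri si; rewrite /cintegral_Rplus /=.
rewrite RintegralB; [|exact: measurable_Rplus|exact: integrable_RplusZ|exact:
  integrable_RplusZ].
rewrite RintegralD; [|exact: measurable_Rplus|exact: integrable_RplusZ|exact:
  integrable_RplusZ].
by rewrite !RintegralZl//; exact: measurable_Rplus.
Qed.

Lemma cintegral_Rplus_eq (f g : R -> R[i]) : (forall x : R, 0 < x -> f x = g x) ->
  cintegral_Rplus f = cintegral_Rplus g.
Proof.
by move=> fg; rewrite /cintegral_Rplus; congr (_ +i* _); apply: eq_Rintegral => x;
  rewrite inE => x0; rewrite fg.
Qed.

(** The ordinary Hankel transform of x^(mu + 1/2) (a_0 + i b_0), already in the form required by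
    [Kmu_disk]. *)
Definition hankel_pair (a b : nat -> R -> R) (eta : R) : R[i] :=
  (eta `^ (mu + 2^-1))%:C *
    (hankel_chain mu (a 0%N) 0 eta +i* hankel_chain mu (b 0%N) 0 eta).

Lemma frht_chirp_dilate phi M (a b : nat -> R -> R) (e xi : R) :
  is_chain a -> is_chain b -> chain_bound M a -> chain_bound M b ->
  (forall x : R, 0 < x -> phi x = (x `^ (mu + 2^-1))%:C * (a 0%N x +i* b 0%N x)) ->
  0 < e -> 0 < xi ->
  frht mu alpha (fun x => cis (cot alpha / e ^+ 2 * (x / e^-1) ^+ 2 / 2) *
    phi (x / e^-1)) xi
  = frht_const mu alpha * (e^-1)%:C *
    (cis (- cot alpha * xi ^+ 2 / 2) * hankel_pair a b (csc alpha / e * xi)).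
Proof.
move=> ca cb Ma Mb phiE e0 xi0; have s0 := csc_gt0; set s := csc alpha in s0 *.
have em : e != 0 by rewrite gt_eqF.
pose p := mu + 2^-1.
(* The powers (x xi s)^p of the kernel and (e x)^p of the test function combine to [K] x^(2 mu +
   1). *)
pose K := ((xi * s) * e) `^ p.
pose r (u : nat -> R -> R) x := K *
  (x `^ (2 * mu + 1) * u 0%N (e * x) * bessel_reduced mu (x * (xi * s))).
have xis0 : 0 < xi * s by rewrite mulr_gt0.
have p0 : 0 <= 2 * mu + 1 by move: mu2; lra.
have dec (u : nat -> R -> R) : is_chain u -> chain_bound M u ->
  rapid_decay (M ^~ 0%N) (u 0%N).
  by move=> cu Mu; exact: chain_rapid_decay.
have dece (u : nat -> R -> R) : is_chain u -> chain_bound M u ->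
    exists B, rapid_decay B (fun x => u 0%N (e * x)).
  move=> cu Mu; eexists.
  have := chain_rapid_decay 0 (is_chain_scale e0 cu) (chain_bound_scale e0 Mu).
  by rewrite (_ : (fun x => _ * _) = fun x => u 0%N (e * x)); [exact|apply/funext => x;
    rewrite muln0 mul1r].
have intr u : is_chain u -> chain_bound M u -> lambda.-integrable Rplus (EFin \o r u).
  move=> cu Mu; have [B dB] := dece _ cu Mu; apply: integrable_RplusZ.
  exact: hankel_integrable mu2 (ltW xis0) p0 dB.
have rE u : is_chain u -> chain_bound M u -> \int[lambda]_(x in Rplus) r u x =
    e^-1 * ((s / e * xi) `^ p * hankel_chain mu (u 0%N) 0 (s / e * xi)).
  move=> cu Mu; have [B dB] := dece _ cu Mu.
  rewrite /r RintegralZl;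
    [|exact: measurable_Rplus|exact: hankel_integrable mu2 (ltW xis0) p0 dB].
  have := hankel_reduced_scale e0 xis0 (dec _ cu Mu); rewrite /hankel_reduced => ->.
  rewrite /hankel_chain expr0 mul1r mulr0n addr0 /hankel_reduced.
  rewrite (_ : xi * s / e = s / e * xi); last by field.
  rewrite !mulrA; congr (_ * _).
  have -> : s / e * xi = (xi * s) / e by field.
  have ei0 : 0 <= e^-1 by rewrite invr_ge0 ltW.
  (* As 2 mu + 2 = 2 p + 1, the powers of e reduce to e^p e^(-2 p - 1) = e^-1 e^-p. *)
  rewrite /K (powRM _ (ltW xis0) (ltW e0)) (powRM _ (ltW xis0) ei0).
  rewrite mulrCA -!mulrA; congr (_ * _).
  rewrite (_ : e^-1 = e `^ (-1)); last by rewrite powR_inv1 ?(ltW e0).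
  rewrite -powRrM -!powRD ?(gt_eqF e0) ?implybT//; congr (_ `^ _).
  by rewrite /p; field.

transitivity (cintegral_Rplus (fun x =>
    (frht_const mu alpha * cis (- cot alpha * xi ^+ 2 / 2)) * (r a x +i* r b x))).
  apply: cintegral_Rplus_eq => x x0; rewrite /frht_kernel -/s.
  have xe0 : 0 < x / e^-1 by rewrite divr_gt0 ?invr_gt0.
  have z0 : 0 < x * xi * s by rewrite !mulr_gt0.
  rewrite sqrt_besselJ// phiE//.
  (* The part of the kernel's phase in x is opposite to that of the given chirp; only the part in xi
     survives. *)
  rewrite (_ : - ((x ^+ 2 + xi ^+ 2) / 2 * cot alpha) =
    - cot alpha * xi ^+ 2 / 2 + - (cot alpha / e ^+ 2 * (x / e^-1) ^+ 2 / 2));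
      last by field.
  rewrite cisD.
  set th := cot alpha / e ^+ 2 * _ / 2.
  have cisN : cis (- th) * cis th = 1.
    rewrite -cisD addNr /cis cos0 sin0; apply/eqP; by rewrite eq_complex /= !eqxx.
  have -> : r a x +i* r b x =
    ((x * xi * s) `^ (mu + 2^-1) * bessel_reduced mu (x * xi * s))%:C *
      (((x / e^-1) `^ (mu + 2^-1))%:C * (a 0%N (x / e^-1) +i* b 0%N (x / e^-1))).
    rewrite mulrA -(rmorphM (real_complex R)).
    have KE : (x * xi * s) `^ p * (x / e^-1) `^ p = K * x `^ (2 * mu + 1).
      rewrite -powRM ?(ltW z0) ?(ltW xe0)// invrK.
      rewrite (_ : 2 * mu + 1 = p + p); last by rewrite /p; field.
      rewrite powRD ?(gt_eqF x0) ?implybT// /K -!powRM ?mulr_ge0 ?(ltW x0) ?(ltW s0)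
        ?(ltW xi0) ?(ltW e0)//.
      by congr (_ `^ _); ring.
    apply/eqP; rewrite eq_complex Re_mulRe Im_mulRe /= invrK /r.
    have E (c : R) : K * (x `^ (2 * mu + 1) * c * bessel_reduced mu (x * (xi * s))) =
        (x * xi * s) `^ p * bessel_reduced mu (x * xi * s) * (x * e) `^ p * c.
      by rewrite !mulrA -KE invrK; ring.
    by rewrite [e * x]mulrC !E !eqxx.
  set fc := frht_const _ _; set J := (_ * bessel_reduced _ _)%:C; set P := _%:C * _.
  rewrite (_ : _ * _ = fc * cis (- cot alpha * xi ^+ 2 / 2) * (J * P) *
    (cis (- th) * cis th)).
    by rewrite cisN mulr1.
  by ring.
rewrite cintegral_RplusZ; [|exact: intr|exact: intr].
rewrite !rE// /hankel_pair -/p.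
set q := (s / e * xi) `^ p; set A := hankel_chain _ _ _ _; set B := hankel_chain _ _ _ _.
rewrite (_ : _ +i* _ = (e^-1)%:C * (q%:C * (A +i* B))); first by ring.
by apply/eqP; rewrite eq_complex !Re_mulRe !Im_mulRe /= !eqxx.
Qed.

Lemma hankel_pair_disk M (a b : nat -> R -> R) :
  is_chain a -> is_chain b -> chain_bound M a -> chain_bound M b ->
  exists N, Kmu_disk mu N (hankel_pair a b).
Proof.
move=> ca cb Ma Mb.
have [N1 N1P] := hankel_chain_bound mu2 ca Ma.
have [N2 N2P] := hankel_chain_bound mu2 cb Mb.
exists (fun m k => Num.max (N1 m k) (N2 m k)), (hankel_chain mu (a 0%N)),
  (hankel_chain mu (b 0%N)).
split => //.
- exact: hankel_chainP mu2 (chain_rapid_decay 0 ca Ma).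
- exact: hankel_chainP mu2 (chain_rapid_decay 0 cb Mb).
- by move=> m k x x0; rewrite le_max N1P.
- by move=> m k x x0; rewrite le_max N2P ?orbT.
Qed.

(** The single factor e, which turns the degree m into m + 1, is a balance: dilation by e^-1 gives
    e, the transform gives e^-1, and passing to F(e x) gives e. *)
Lemma chirp_mul_dilate_frht (F : (R -> R[i]) -> R[i]) phi M (a b : nat -> R -> R) (e : R) :
  Kmu_dual mu F -> is_chain a -> is_chain b -> chain_bound M a -> chain_bound M b ->
  (forall x : R, 0 < x -> phi x = (x `^ (mu + 2^-1))%:C * (a 0%N x +i* b 0%N x)) ->
  0 < e ->
  Kmu mu (fun eta => cis (- (e ^+ 2 * cot alpha) * eta ^+ 2 / 2) *
    hankel_pair a b (csc alpha * eta)) ->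
  chirp_mul (cot alpha / e ^+ 2) (dilate e^-1 (frht_dual mu alpha F)) phi
  = frht_const mu alpha * e%:C * dilate e F
     (fun eta => cis (- (e ^+ 2 * cot alpha) * eta ^+ 2 / 2) *
       hankel_pair a b (csc alpha * eta)).
Proof.
move=> dF ca cb Ma Mb phiE e0 KPhi.
have em : e != 0 by rewrite gt_eqF.
set Phi := (fun eta => _) in KPhi *.
have KPsi : Kmu mu (fun x => Phi (x / e)).
  have [N NPhi] := Kmu_Kmu_disk KPhi; have [N' N'P] := Kmu_disk_div mu N e0.
  exact: Kmu_disk_Kmu (N'P _ NPhi).
rewrite /chirp_mul /dilate /frht_dual.
have KcPsi : Kmu mu (fun x => frht_const mu alpha * (e^-1)%:C * Phi (x / e)).
  have := Kmu_lin (frht_const mu alpha * (e^-1)%:C) KPsi (Kmu0 mu).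
  by rewrite (_ : (fun x => _) = fun x => frht_const mu alpha * (e^-1)%:C * Phi (x / e));
    [|apply/funext => x; rewrite addr0].
rewrite -(Kmu_dual_ext dF KcPsi); last first.
  move=> x x0; rewrite (frht_chirp_dilate ca cb Ma Mb phiE e0 x0) /Phi.
  congr (_ * (cis _ * hankel_pair _ _ _)); by field.
rewrite (Kmu_dualZ dF)// invrK.
by ring.
Qed.

End hankel_of_dilates.

Local Close Scope complex_scope.

Theorem theorem4p5 (R : realType) (mu alpha m : R) (L : R -> R)
    (f : (R -> R[i]) -> R[i])
    (hmu : - 2^-1 <= mu)
    (halpha : 0 < alpha < pi)
    (hL : slowly_varying0 L)
    (hLbounds : exists C1 C2 : R, 0 < C1 /\ 0 < C2 /\
       forall x, 1 < x -> C1 < L x < C2)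
    (hf : Kmu_dual mu f)
    (hqb : quasi_asymp_bounded0 mu m L f) :
  forall phi : R -> R[i], Kmu mu phi ->
    exists C : R, 0 < C /\
      \forall e \near 0^'+,
        cabs (chirp_mul (cot alpha / e ^+ 2)
                (dilate e^-1 (frht_dual mu alpha f)) phi)
        <= C * (e `^ (m + 1) * L e).
Proof.
move=> phi /Kmu_Kmu_disk[M [a [b [ca cb Ma Mb phiE]]]].
have [N NP] := hankel_pair_disk hmu ca cb Ma Mb.
(* The bounds are those of [Kmu_disk_scale] for eta -> c_2 eta; |cot alpha| dominates every chirp
   parameter with e <= 1. *)
have [N' N'P] := Kmu_disk_chirp mu `|cot alpha|
  (fun m k => `|csc alpha `^ (mu + 2^-1)| *
    (csc alpha ^+ (2 * k) / csc alpha ^+ m * N m k)).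
pose Phi (e : R) eta := cis (- (e ^+ 2 * cot alpha) * eta ^+ 2 / 2) *
  hankel_pair mu a b (csc alpha * eta).
have PhiP e : 0 < e -> e <= 1 -> Kmu_disk mu N' (Phi e).
  move=> e0 e1; apply: N'P; last exact: Kmu_disk_scale (csc_gt0 halpha) NP.
  rewrite normrN normrM ger0_norm ?sqr_ge0// ler_piMl//.
  by rewrite expr_le1// ltW.
have [_ L0 _] := hL.
have [C [C0 HC]] := quasi_asymp_bounded0_disk hf L0 hqb PhiP.
pose K := cabs (frht_const mu alpha) + 1.
have K0 : 0 < K by rewrite ltr_wpDl// cabs_ge0.
exists (K * C); split; first exact: mulr_gt0.
near=> e.
have e0 : 0 < e by near: e; exact: nbhs_right_gt.
have e1 : e <= 1 by near: e; exact: nbhs_right_le.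
have HCe : cabs (dilate e f (Phi e)) <= C * (e `^ m * L e) by near: e; exact: HC.
rewrite (chirp_mul_dilate_frht hmu halpha hf ca cb Ma Mb phiE e0
  (Kmu_disk_Kmu (PhiP e e0 e1))).
rewrite -/(Phi e) (cabsM _ (dilate e f (Phi e))) (cabsM (frht_const mu alpha)) cabs_real
  (gtr0_norm e0).
rewrite powRD ?(gt_eqF e0) ?implybT// powRr1 ?(ltW e0)//.
rewrite (_ : K * C * _ = (K * e) * (C * (e `^ m * L e))); last by ring.
apply: (ler_pM _ _ _ HCe); [by apply: mulr_ge0;
  [exact: cabs_ge0|exact: ltW]|exact: cabs_ge0|].
by rewrite ler_wpM2r ?(ltW e0)// lerDl.
Unshelve. all: by end_near. Qed.
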